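(* Let $a\in\mathbb{D}$. Then 1. $N(R_a-I)=\{f\in\mathcal{H}: C_{\omega_a}(|1-\bar a z|^{1/2}f)\in\mathcal{E}\}=M_{\frac{1}{|1-\bar a z|^{1/2}}}C_{\omega_a}\mathcal{E}$. 2. $N(R_a+I)=\{g\in\mathcal{H}: C_{\omega_a}(|1-\bar a z|^{1/2}g)\in\mathcal{O}\}=M_{\frac{1}{|1-\bar a z|^{1/2}}}C_{\omega_a}\mathcal{O}$.
   Context: $\mathbb{D}=\{z\in\mathbb{C}:|z|<1\}$, $\mathbb{T}=\{z\in\mathbb{C}:|z|=1\}$, and $\mathcal{H}=L^2(\mathbb{T})$ with respect to normalized Lebesgue measure. For $a\in\mathbb{D}$, $\varphi_a(z)=\frac{a-z}{1-\bar a z}$ and $C_a:\mathcal{H}\to\mathcal{H}$ is the bounded composition operator $C_af=f\circ\varphi_a$ (so $C_a^2=I$). $M_h$ denotes multiplication by $h$. $R_a$ is the unitary part in the polar decomposition $C_a=R_a|C_a|$; explicitly $R_a=(1-|a|^2)^{1/2}M_{\frac{1}{|1-\bar a z|}}C_a$, and $R_a$ is a symmetry ($R_a^*=R_a=R_a^{-1}$). $\omega_a$ is the unique fixed point of $\varphi_a$ in $\mathbb{D}$: $\omega_a=\frac{1}{\bar a}\left(1-\sqrt{1-|a|^2}\right)$ if $a\neq 0$, and $\omega_0=0$. $\mathcal{E}\subset\mathcal{H}$ is the closed subspace of even elements ($f(-z)=f(z)$ a.e. in $\mathbb{T}$) and $\mathcal{O}\subset\mathcal{H}$ the closed subspace of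 odd elements ($f(-z)=-f(z)$ a.e.). $N(T)$ denotes the nullspace of $T$. *)

(* Defs.v *)
From HB Require Import structures.
From mathcomp Require Import all_boot all_order all_algebra.
From mathcomp Require Import complex ring lra.
From mathcomp Require Import all_classical all_reals all_analysis.
From mathcomp Require Import measurable_realfun.

Set Implicit Arguments.
Unset Strict Implicit.
Unset Printing Implicit Defensive.
Import Order.TTheory GRing.Theory Num.Theory.
Import numFieldNormedType.Exports.
Local Open Scope classical_set_scope.
Local Open Scope ring_scope.
Local Open Scope complex_scope.
Local Open Scope quotient_scope.

Import Normc.
Local Notation cRe := (@complex.Re _).
Local Notation cIm := (@complex.Im _).

Section Modulus.
Variable R : realType.
Implicit Types z w : R[i].

Lemma normcR z : `|z| = (normc z)%:C.
Proof. by case: z. Qed.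

Lemma normc_ge0 z : 0 <= normc z.
Proof. by case: z => x y; exact: sqrtr_ge0. Qed.

Lemma normc_sqr z : normc z ^+ 2 = cRe z ^+ 2 + cIm z ^+ 2.
Proof. by case: z => x y; rewrite sqr_sqrtr// addr_ge0// sqr_ge0. Qed.

Lemma normc_lt1 z : (`|z| < 1) = (normc z < 1).
Proof. by rewrite normcR -[X in _ < X](rmorph1 (real_complex R)) ltcR. Qed.

End Modulus.

Record disc (R : realType) := Disc {
  disc_val :> R[i] ;
  disc_lt1 : `|disc_val| < 1 }.

Record circle (R : realType) := Circle {
  circle_val :> R[i] ;
  circle_eq1 : `|circle_val| == 1 }.

HB.instance Definition _ (R : realType) := [isSub for @circle_val R].
HB.instance Definition _ (R : realType) := [Choice of circle R by <:].

Section CircleMeasure.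
Variable R : realType.

Definition circle_one : circle R := @Circle R 1 (introT eqP (normr1 _)).
HB.instance Definition _ := isPointed.Build (circle R) circle_one.

Definition circle_coord (z : circle R) : R * R := (cRe z, cIm z).

(* The Borel sigma-algebra of the circle, as the trace of that of the plane. *)
HB.instance Definition _ :=
  Measurable.copy (circle R) (g_sigma_algebra_preimageType circle_coord).

Lemma expi_subproof (t : R) : `|cos t +i* sin t| == 1.
Proof. by rewrite normc_def/= cos2Dsin2 sqrtr1. Qed.

Definition expi (t : measurableTypeR R) : circle R := Circle (expi_subproof t).

Lemma measurable_expi : measurable_fun [set: measurableTypeR R] expi.
Proof.
move=> _ _ [B mB <-]; rewrite !setTI -comp_preimage -[X in measurable X]setTI.
have : measurable_fun [set: measurableTypeR R] (circle_coord \o expi).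
  apply: measurable_fun_pair => /=;
    [exact: (continuous_measurable_fun (@continuous_cos R))
    |exact: (continuous_measurable_fun (@continuous_sin R))].
by apply.
Qed.

HB.instance Definition _ :=
  isMeasurableFun.Build _ _ (measurableTypeR R) (circle R) expi measurable_expi.

Lemma pi2_gt0 : 0 < pi *+ 2 :> R.
Proof. by rewrite mulrn_wgt0// pi_gt0. Qed.

(* Normalized Lebesgue measure: the image of the uniform probability on
   [0, 2 pi] under t |-> exp (i t). *)
Definition arc_measure : probability (circle R) R :=
  distribution (uniform_prob pi2_gt0) (expi : {mfun measurableTypeR R >-> circle R}).

End CircleMeasure.

Section MobiusCircle.
Variable R : realType.
Implicit Types (a : disc R) (z : circle R).

Lemma circle_opp_subproof z : `|- circle_val z| == 1.
Proof. by rewrite normrN circle_eq1. Qed.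

Definition circle_opp z : circle R := Circle (circle_opp_subproof z).

Definition mobius (a z : R[i]) : R[i] := (a - z) / (1 - a^* * z).

Lemma mobius_subproof a z : `|mobius a z| == 1.
Proof.
have z1 : `|circle_val z| = 1 by apply/eqP; exact: circle_eq1.
have zJ : (circle_val z)^* * z = 1 by rewrite mulrC -sqr_normc z1 expr1n.
have az : `|disc_val a - circle_val z| != 0.
  rewrite normr_eq0 subr_eq0; apply/negP => /eqP az.
  by have := disc_lt1 a; rewrite az z1 ltxx.
have E : `|1 - (disc_val a)^* * circle_val z| = `|disc_val a - circle_val z|.
  rewrite distrC -[RHS]normcJ -[RHS]mulr1 -{2}z1 -normrM.
  by rewrite rmorphB/= mulrBl zJ.
by rewrite /mobius normf_div E divff.
Qed.

Definition mobius_circle a z : circle R := Circle (mobius_subproof a z).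

Definition fixpoint (a : R[i]) : R[i] :=
  if a == 0 then 0 else (1 - (Num.sqrt (1 - normc a ^+ 2))%:C) / a^*.

Lemma fixpoint_subproof a : `|fixpoint a| < 1.
Proof.
rewrite /fixpoint; case: ifPn => [_|a0]; first by rewrite normr0 ltr01.
have r1 : normc (disc_val a) < 1 by rewrite -normc_lt1 disc_lt1.
have r0 : 0 < normc (disc_val a).
  by rewrite -ltcR -normcR normr_gt0.
set r := normc _ in r1 r0 *.
have s0 : 0 <= 1 - r ^+ 2 by nra.
rewrite normf_div normcJ [X in _ / X]normcR -/r.
rewrite -(rmorph1 (real_complex R)) -rmorphB/=.
set s := Num.sqrt _.
have ss : s ^+ 2 = 1 - r ^+ 2 by rewrite sqr_sqrtr.
have s_ge0 : 0 <= s by exact: sqrtr_ge0.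
have s_le1 : s <= 1 by nra.
rewrite ger0_norm ?ler0c ?subr_ge0//.
rewrite -fmorphV -rmorphM ltcR ltr_pdivrMr// mul1r.
nra.
Qed.

Definition omega a : disc R := Disc (fixpoint_subproof a).

Lemma mobius_den_neq0 (a w : disc R) : 1 - (a : R[i])^* * (w : R[i]) != 0.
Proof.
rewrite subr_eq0; apply/negP => /eqP/(congr1 Num.norm).
rewrite normr1 normrM normcJ => E.
have := mulr_ilt1 (normr_ge0 _) (normr_ge0 _) (disc_lt1 a) (disc_lt1 w).
by rewrite -E ltxx.
Qed.

Lemma mobius_fixedE (a w : disc R) :
  mobius a w = w <-> (a : R[i]) - (w : R[i]) = (w : R[i]) * (1 - (a : R[i])^* * (w : R[i])).
Proof.
rewrite /mobius; split => [/eqP|/eqP E]; last first.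
  by apply/eqP; rewrite -[X in _ == X]divr1 eqr_div ?mobius_den_neq0 ?oner_eq0// mulr1.
by rewrite -[X in _ == X]divr1 eqr_div ?mobius_den_neq0 ?oner_eq0// mulr1 => /eqP.
Qed.

Lemma omega_fixed a : mobius a (omega a) = omega a.
Proof.
apply/mobius_fixedE; rewrite /= /fixpoint; case: ifPn => [/eqP ->|a0].
  by rewrite subr0 mul0r.
have aJ0 : (a : R[i])^* != 0 by rewrite conjc_eq0.
have r1 : normc a < 1 by rewrite -normc_lt1 disc_lt1.
set s := (Num.sqrt _)%:C.
have ss : s ^+ 2 = 1 - (a : R[i]) * (a : R[i])^*.
  rewrite /s -rmorphXn/= sqr_sqrtr; last by have := normc_ge0 a; nra.
  by rewrite rmorphB rmorph1 rmorphXn/= -normcR sqr_normc.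
rewrite /= in ss aJ0 *; set b := (disc_val a)^* in ss aJ0 *; move: s ss => s ss.
have bd x : b * (x / b) = x by rewrite mulrC divfK.
rewrite bd opprB addrCA subrr addr0.
have -> : (1 - s) / b * s = (s - s ^+ 2) / b by field.
by rewrite ss; field.
Qed.

Lemma omega_unique (a w : disc R) : mobius a w = w -> w = omega a :> R[i].
Proof.
move=> /mobius_fixedE wE; have /mobius_fixedE oE := omega_fixed a.
apply/eqP; rewrite -subr_eq0.
have : ((w : R[i]) - (omega a : R[i])) * ((a : R[i])^* * ((w : R[i]) + (omega a : R[i])) - 2) = 0.
  rewrite [LHS](_ : _ = ((a : R[i]) - (w : R[i]) - (w : R[i]) * (1 - (a : R[i])^* * (w : R[i])))
    - ((a : R[i]) - (omega a : R[i]) - (omega a : R[i]) * (1 - (a : R[i])^* * (omega a : R[i])))).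
    by rewrite wE oE !subrr.
  by move: (disc_val (omega a)) (disc_val w) (disc_val a) (disc_val a)^* => o w' a' b; ring.
move/eqP; rewrite mulf_eq0 => /orP[//|/eqP/subr0_eq].
move/(congr1 (fun x : R[i] => `|x|)).
rewrite /= normr_nat normrM normcJ => E.
have wo : `|(w : R[i]) + (omega a : R[i])| < 2.
  by rewrite (le_lt_trans (ler_normD _ _))// (ltrD (disc_lt1 w) (disc_lt1 (omega a))).
have : `|a : R[i]| * `|(w : R[i]) + (omega a : R[i])| < 2.
  rewrite (le_lt_trans _ wo)// ler_piMl// ltW//; exact: disc_lt1.
by rewrite E ltxx.
Qed.

End MobiusCircle.

Section L2.
Variable R : realType.
Local Notation mu := (@arc_measure R).
Implicit Types f g : circle R -> R[i].

Definition square_integrable f :=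
  [/\ measurable_fun setT (cRe \o f), measurable_fun setT (cIm \o f) &
      (\int[mu]_z (normc (f z) ^+ 2)%:E < +oo)%E].

Definition L2pred : {pred circle R -> R[i]} := [pred f | `[< square_integrable f >]].

Lemma measurable_normc_sqr f : measurable_fun setT (cRe \o f) ->
  measurable_fun setT (cIm \o f) -> measurable_fun setT (fun z => normc (f z) ^+ 2).
Proof.
move=> mR mI; under eq_fun do rewrite normc_sqr.
by apply: measurable_funD; exact: measurable_funX.
Qed.

Lemma normc_sqr_lin (c x y : R[i]) :
  normc (c * x + y) ^+ 2 <= 2 * normc c ^+ 2 * normc x ^+ 2 + 2 * normc y ^+ 2.
Proof.
rewrite !normc_sqr; case: c x y => [c1 c2] [x1 x2] [y1 y2] /=.
have := sqr_ge0 (c1 * x1 - c2 * x2 - y1).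
have := sqr_ge0 (c1 * x2 + c2 * x1 - y2).
nra.
Qed.

Lemma L2pred_submod_closed : submod_closed L2pred.
Proof.
split.
  apply/asboolP; split; [exact: measurable_cst|exact: measurable_cst|].
  under eq_integral do rewrite normc0 expr0n/=.
  by rewrite integral0 ltry.
move=> c f g /asboolP[fR fI f2] /asboolP[gR gI g2]; apply/asboolP.
have hR : measurable_fun setT (cRe \o (c *: f + g)).
  rewrite (_ : _ \o _ = (fun z => cRe c * cRe (f z) - cIm c * cIm (f z) + cRe (g z))).
    apply: measurable_funD => //; apply: measurable_funB;
      by apply: measurable_funM => //; exact: measurable_cst.
  by apply/funext => z /=; rewrite [(_ + _) z]/(c * f z + g z); case: (c) (f z) (g z) => [? ?] [? ?] [].
have hI : measurable_fun setT (cIm \o (c *: f + g)).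
  rewrite (_ : _ \o _ = (fun z => cRe c * cIm (f z) + cIm c * cRe (f z) + cIm (g z))).
    apply: measurable_funD => //; apply: measurable_funD;
      by apply: measurable_funM => //; exact: measurable_cst.
  by apply/funext => z /=; rewrite [(_ + _) z]/(c * f z + g z); case: (c) (f z) (g z) => [? ?] [? ?] [].
split => //.
have mf := measurable_normc_sqr fR fI; have mg := measurable_normc_sqr gR gI.
apply: (@le_lt_trans _ _ (\int[mu]_z ((2 * normc c ^+ 2)%:E * (normc (f z) ^+ 2)%:E
   + 2%:E * (normc (g z) ^+ 2)%:E))%E).
  apply: ge0_le_integral => //.
  - by move=> z _; rewrite lee_fin sqr_ge0.
  - by apply/measurable_EFinP; exact: measurable_normc_sqr.
  - by apply: emeasurable_funD; apply: measurable_funeM; apply/measurable_EFinP.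
  - by move=> z _; rewrite -!EFinM -EFinD lee_fin; exact: normc_sqr_lin.
rewrite ge0_integralD//=; first last.
- by apply: measurable_funeM; apply/measurable_EFinP.
- by move=> z _; rewrite -EFinM lee_fin mulr_ge0// sqr_ge0.
- by apply: measurable_funeM; apply/measurable_EFinP.
- by move=> z _; rewrite -EFinM lee_fin mulr_ge0// ?sqr_ge0// mulr_ge0// sqr_ge0.
rewrite !ge0_integralZl_EFin//; do ?[by apply/measurable_EFinP];
  do ?[by move=> z _; rewrite lee_fin sqr_ge0]; do ?[by rewrite mulr_ge0 ?sqr_ge0].
apply: lte_add_pinfty; apply: lte_mul_pinfty => //.
by rewrite lee_fin mulr_ge0// sqr_ge0.
Qed.

HB.instance Definition _ := GRing.isSubmodClosed.Build _ _ L2pred L2pred_submod_closed.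

Record L2fun := MkL2fun { L2val :> circle R -> R[i]; _ : L2val \in L2pred }.
HB.instance Definition _ := [isSub for L2val].
HB.instance Definition _ := [Choice of L2fun by <:].
HB.instance Definition _ := [SubChoice_isSubLmodule of L2fun by <:].

Definition ae_null : {pred L2fun} := [pred f : L2fun | `[< \forall z \ae mu, f z = 0 >]].

Lemma ae_null_submod_closed : submod_closed ae_null.
Proof.
split; first by apply/asboolP; apply: aeW.
move=> c f g /asboolP f0 /asboolP g0; apply/asboolP.
apply: filterS2 f0 g0 => z /= fz gz; transitivity (c * f z + g z : R[i]) => //.
by rewrite fz gz mulr0 addr0.
Qed.

HB.instance Definition _ := GRing.isSubmodClosed.Build _ _ ae_null ae_null_submod_closed.

Definition L2 : Type := {ideal_quot ae_null}.
HB.instance Definition _ := GRing.Zmodule.on L2.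
HB.instance Definition _ := EqQuotient.on L2.

Definition L2_scale (c : R[i]) : L2 -> L2 := lift_op1 L2 (fun f : L2fun => c *: f).

Lemma L2_eqP (x y : L2fun) :
  reflect (\forall z \ae mu, x z = y z) (x == y %[mod L2]).
Proof.
rewrite -Quotient.idealrBE [X in reflect _ X]/(`[< _ >]); apply: (iffP (asboolP _)); apply: filterS => z /=.
  by move/subr0_eq.
by move=> xy; transitivity ((x z : R[i]) - y z) => //; rewrite xy subrr.
Qed.

Lemma pi_scale c : {morph \pi_L2 : x / c *: x >-> L2_scale c x}.
Proof.
move=> x; unlock L2_scale; apply/eqP/L2_eqP.
have /eqP/L2_eqP : \pi_L2 x = \pi_L2 (repr (\pi_L2 x)) by rewrite reprK.
by apply: filterS => z xz; transitivity (c * x z) => //; rewrite xz.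
Qed.

Lemma pi_addE (x y : L2fun) : \pi_L2 (x + y) = \pi_L2 x + \pi_L2 y.
Proof. exact: Quotient.pi_add. Qed.

Lemma L2_scaleA c d x : L2_scale c (L2_scale d x) = L2_scale (c * d) x.
Proof. by rewrite -[x]reprK -!pi_scale scalerA. Qed.

Lemma L2_scale1 : left_id 1 L2_scale.
Proof. by move=> x; rewrite -[x]reprK -!pi_scale scale1r. Qed.

Lemma L2_scaleDr : right_distributive L2_scale +%R.
Proof.
by move=> c x y; rewrite -[x]reprK -[y]reprK -!pi_scale -!pi_addE -pi_scale scalerDr.
Qed.

Lemma L2_scaleDl x : {morph L2_scale^~ x : c d / c + d}.
Proof. by move=> c d; rewrite -[x]reprK -!pi_scale -pi_addE scalerDl. Qed.

HB.instance Definition _ := GRing.Zmodule_isLmodule.Build R[i] L2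
  L2_scaleA L2_scale1 L2_scaleDr L2_scaleDl.

(* Evaluation of a class through its canonical representative: only properties
   of [L2eval x] that hold up to a null set are meaningful. *)
Definition L2eval (x : L2) : circle R -> R[i] := repr x.
Coercion L2eval : L2 >-> Funclass.

(* The class of f, with the junk value 0 when f is not square integrable.  The
   junk value is not reached below: the weights and their inverses are bounded
   on the circle, and the Moebius maps distort arc length by a bounded factor,
   so they also preserve null sets. *)
Definition L2class f : L2 := \pi_L2 (insubd (0 : L2fun) f).

Lemma L2classK f : square_integrable f -> \forall z \ae mu, L2class f z = f z.
Proof.
move=> f2; have fL : f \in L2pred by apply/asboolP.
have /eqP/L2_eqP : \pi_L2 (repr (L2class f)) = L2class f by rewrite reprK.
by apply: filterS => z; rewrite /L2eval => ->; rewrite insubdK.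
Qed.

Lemma L2evalK (x : L2) : L2class x = x.
Proof. by rewrite -[RHS]reprK /L2class /L2eval; congr \pi; rewrite valKd. Qed.

Definition cintegral f : R[i] :=
  (\int[mu]_z cRe (f z)) +i* (\int[mu]_z cIm (f z)).

Definition L2dot (x y : L2) : R[i] := cintegral (fun z => x z * (y z)^*).

Definition L2norm (x : L2) : R := Num.sqrt (cRe (L2dot x x)).

End L2.

Section Operators.
Variable R : realType.
Local Notation H := (L2 R).
Implicit Types (T A B C U P : H -> H).

Definition bounded_operator T :=
  linear T /\ exists K : R, forall x, L2norm (T x) <= K * L2norm x.

Definition adjoint A B := forall x y, L2dot (A x) y = L2dot x (B y).

Definition unitary_operator U :=
  [/\ bounded_operator U, forall x y, L2dot (U x) (U y) = L2dot x y
    & forall y, exists x, U x = y].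

(* The order of R[i] makes this say that <P x, x> is a nonnegative real. *)
Definition positive_operator P :=
  bounded_operator P /\ forall x, 0 <= L2dot (P x) x.

(* P = |C|, the positive square root of C^* C. *)
Definition absolute_value C P :=
  positive_operator P /\
  exists2 B, bounded_operator B /\ adjoint C B & P \o P = B \o C.

(* For an invertible C the partial isometry in the polar decomposition
   C = U |C| is unitary. *)
Definition polar_unitary_part C U :=
  unitary_operator U /\ exists2 P, absolute_value C P & C = U \o P.

Definition nullspace T : set H := [set x | T x = 0].

Definition composition (a : disc R) : H -> H :=
  fun x => L2class (x \o mobius_circle a).

Definition multiplication (h : circle R -> R) : H -> H :=
  fun x => L2class (fun z => (h z)%:C * x z).

Definition even_subspace : set H :=
  [set x : H | \forall z \ae @arc_measure R, x (circle_opp z) = x z].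

Definition odd_subspace : set H :=
  [set x : H | \forall z \ae @arc_measure R, x (circle_opp z) = - x z].

Definition weight (a : disc R) (z : circle R) : R :=
  Num.sqrt (normc (1 - (a : R[i])^* * (z : R[i]))).

End Operators.

Arguments even_subspace {R}.
Arguments odd_subspace {R}.

(* Main.v *)
From HB Require Import structures.
Require Import Defs.
From mathcomp Require Import all_boot all_order all_algebra.
From mathcomp Require Import complex ring lra.
From mathcomp Require Import all_classical all_reals all_analysis.
From mathcomp Require Import measurable_realfun.

(** Write [phi_b] for the Moebius involution attached to [b] in the disc,
    [J = |phi_a'|] for the density on the circle of the push-forward of arc
    length by [phi_a], and [w = |1 - conj a z|^(1/2)] for the weight.

    Two pointwise identities carry the theorem.  The first is
    [phi_a o phi_omega = phi_omega o (-1)] (lemma [mobius_omega]): the map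
    [phi_omega] carries the fixed point [omega] of [phi_a] to [0], and an
    involutive automorphism of the disc fixing [0] is [z |-> - z].  So
    [C_omega] conjugates [C_a] to the reflection [f |-> f (- z)].  The second
    is [w (phi_a z) = w z * sqrt (J z)] (lemma [weight_mobius]): as
    [R_a = M_(sqrt J) C_a], multiplication by [w] conjugates [R_a] to [C_a].
    Together, [R_a f = e f] if and only if the function [C_omega (w f)] is
    multiplied by [e] under [z |-> - z]; the cases [e = 1] and [e = -1] are the
    two nullspaces.  The descriptions as images hold because [C_omega] is an
    involution and [M_w] is inverse to [M_(1/w)].

    What remains is the formula for [R_a], which is only known to be a unitary
    factor in some factorization [C_a = R_a P] with [P] positive and
    [P^2 = C_a^* C_a].  The change of variables [z |-> phi_a z] on the circle
    gives [C_a^* C_a = M_J], whose positive square root [M_(sqrt J)] is bounded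
    below; uniqueness of the positive square root gives [P = M_(sqrt J)], and
    inverting this multiplication operator gives [R_a].

    The uniqueness (theorem [positive_square_root_unique]) is obtained without
    functional calculus.  Let [P^2 = Q^2] with [P >= 0] and [Q >= c > 0], and
    [D = P - Q].  Then [P D = - D Q], hence
    [<Q x, D^2 x> = - <P D x, D x> <= 0] for every [x].  But at a vector [x]
    where [|D x|] nearly attains [|D| |x|], one has [D^2 x ~ |D|^2 x], so that
    [<Q x, D^2 x>] is about [|D|^2 <Q x, x> >= c |D|^2 |x|^2].  So [D = 0].

    For the change of variables, [phi_a (exp (i t)) = exp (i theta t)] where
    [theta] is an explicit increasing function with derivative
    [J (exp (i t))] and [theta (t + 2 pi) = theta t + 2 pi]; this reduces the
    matter to substitution in Lebesgue integrals on the line. *)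

Set Implicit Arguments.
Unset Strict Implicit.
Unset Printing Implicit Defensive.
Import Order.TTheory GRing.Theory Num.Theory.
Import numFieldNormedType.Exports.
Local Open Scope classical_set_scope.
Local Open Scope ring_scope.
Local Open Scope complex_scope.
Local Open Scope quotient_scope.
Import Normc.
Local Notation cRe := (@complex.Re _).
Local Notation cIm := (@complex.Im _).

(** * Uniqueness of positive square roots *)

Section SquareRoot.
Variables (R : realType) (V : lmodType R[i]) (dot : V -> V -> R[i]).
Hypothesis dotP : forall (c : R[i]) (x y z : V),
  dot (c *: x + y) z = c * dot x z + dot y z.
Hypothesis dotC : forall x y, dot y x = conjc (dot x y).
Hypothesis dot_ge0 : forall x, 0 <= dot x x.
Hypothesis dot_eq0 : forall x, dot x x = 0 -> x = 0.

Local Notation im := (Complex 0 1 : R[i]).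

Let im_neq0 : im != 0.
Proof. by rewrite eq_complex/= oner_eq0 andbF. Qed.

Let conjc_im : conjc im = - im.
Proof. by apply/eqP; rewrite eq_complex/= oppr0 !eqxx. Qed.

(** Complex polarization: the values at [(x + y, x + y)] and at
    [(x + i y, x + i y)] give [B x y + B y x = 0] and [B x y - B y x = 0]. *)
Lemma sesq_eq0 (B : V -> V -> R[i]) :
  (forall x x' y, B (x + x') y = B x y + B x' y) ->
  (forall x y y', B x (y + y') = B x y + B x y') ->
  (forall x y, B (im *: x) y = im * B x y) ->
  (forall x y, B x (im *: y) = - im * B x y) ->
  (forall x, B x x = 0) -> forall x y, B x y = 0.
Proof.
move=> BDl BDr Bil Bir B0 x y.
have E1 : B x y + B y x = 0.
  by have := B0 (x + y); rewrite BDl !BDr !B0 addr0 add0r.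
have := B0 (x + im *: y); rewrite BDl !BDr !Bir !Bil !B0.
rewrite ?mulr0 ?addr0 ?add0r mulNr addrC.
move=> /subr0_eq /(mulfI (im_neq0)) E2.
by move: E1; rewrite E2 -mulr2n => /eqP; rewrite mulrn_eq0 => /eqP.
Qed.

Let ip x y : R := cRe (dot x y).
Let N x := ip x x.

Let dotDl x y z : dot (x + y) z = dot x z + dot y z.
Proof. by have := dotP 1 x y z; rewrite scale1r mul1r. Qed.

Let dot0l z : dot 0 z = 0.
Proof. by have /eqP := dotDl 0 0 z; rewrite addr0 -subr_eq subrr eq_sym => /eqP. Qed.

Let dotZl c x z : dot (c *: x) z = c * dot x z.
Proof. by have := dotP c x 0 z; rewrite !addr0 dot0l addr0. Qed.

Let dotDr x y z : dot z (x + y) = dot z x + dot z y.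
Proof. by rewrite dotC dotDl rmorphD/= -!dotC. Qed.

Let dotZr c x z : dot z (c *: x) = conjc c * dot z x.
Proof. by rewrite dotC dotZl rmorphM/= -dotC. Qed.

Let dotBl x y z : dot (x - y) z = dot x z - dot y z.
Proof. by rewrite dotDl -scaleN1r dotZl mulN1r. Qed.

(** [B x y = <A x, y> - <x, A y>] is sesquilinear, and it vanishes on the
    diagonal because [<A x, x>] is real. *)
Lemma real_form_symmetric (A : {linear V -> V}) :
  (forall x, cIm (dot (A x) x) = 0) ->
  forall x y, dot (A x) y = dot x (A y).
Proof.
move=> Areal x y.
pose B u v := dot (A u) v - dot u (A v).
suff : B x y = 0 by move=> /subr0_eq.
apply: (@sesq_eq0 B) => [u u' v|u v v'|u v|u v|u]; rewrite /B.
- by rewrite raddfD !dotDl opprD addrACA.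
- by rewrite raddfD !dotDr opprD addrACA.
- by rewrite linearZ !dotZl mulrBr.
- by rewrite linearZ !dotZr conjc_im mulrBr.
- apply/eqP; rewrite subr_eq0 [X in _ == X]dotC eq_sym; apply/eqP.
  by move: (Areal u); case: (dot _ _) => p q /= ->; rewrite oppr0.
Qed.

Let ipDl x y z : ip (x + y) z = ip x z + ip y z.
Proof. by rewrite /ip dotDl; case: (dot x z) (dot y z) => [? ?] []. Qed.

Let ipC x y : ip x y = ip y x.
Proof. by rewrite /ip [in RHS]dotC; case: (dot x y). Qed.

Let ipDr x y z : ip z (x + y) = ip z x + ip z y.
Proof. by rewrite ipC ipDl !(ipC z). Qed.

Let ipZl (k : R) x z : ip (k%:C *: x) z = k * ip x z.
Proof. by rewrite /ip dotZl; case: (dot x z) => p q /=; rewrite mul0r subr0. Qed.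

Let ipZr (k : R) x z : ip z (k%:C *: x) = k * ip z x.
Proof. by rewrite ipC ipZl ipC. Qed.

Let ipBl x y z : ip (x - y) z = ip x z - ip y z.
Proof.
have -> : x - y = x + (-1)%:C *: y by rewrite rmorphN1 scaleN1r.
by rewrite ipDl ipZl mulN1r.
Qed.

Let ipBr x y z : ip z (x - y) = ip z x - ip z y.
Proof. by rewrite ipC ipBl !(ipC z). Qed.

Let N_ge0 x : 0 <= N x.
Proof. by have := dot_ge0 x; rewrite /N /ip lecE => /andP[]. Qed.

Let N_subZ (k : R) u x :
  N (u - k%:C *: x) = N u - 2 * k * ip u x + k * (k * N x).
Proof.
rewrite /N ipBl !ipBr !ipZl !ipZr (ipC x u); ring.
Qed.

Let N_eq0 x : N x = 0 -> x = 0.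
Proof.
move=> Nx; apply: dot_eq0; move: (dot_ge0 x) Nx; rewrite /N /ip lecE.
by case: (dot x x) => p q /= /andP[/eqP -> _] ->.
Qed.

Let ip_young (d : R) x y : 0 < d -> - (2 * ip x y) <= d * N x + d^-1 * N y.
Proof.
move=> d0; have := N_ge0 (d%:C *: x + y).
rewrite /N ipDl !ipDr !ipZl !ipZr (ipC y x) => H.
rewrite -subr_ge0 -(pmulr_rge0 _ d0).
suff -> : d * (d * ip x x + d^-1 * ip y y - - (2 * ip x y)) =
   d * (d * ip x x) + d * ip x y + (d * ip x y + ip y y) by [].
by field; rewrite gt_eqF.
Qed.

(** The number [s] is the square of the operator norm of [D].  It is produced
    together with almost maximizing vectors, since the norm need not be attained. *)
Let least_bound (D : V -> V) (K : R) : (forall x, N (D x) <= K * N x) ->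
  exists s : R, [/\ 0 <= s, forall x, N (D x) <= s * N x &
    forall e : R, 0 < e -> 0 < s -> exists2 x, 0 < N x & (s - e) * N x <= N (D x)].
Proof.
move=> DK.
pose E := [set k : R | 0 <= k /\ forall x, N (D x) <= k * N x].
have E0 : E !=set0.
  exists `|K|; split => // x; apply: (le_trans (DK x)).
  by rewrite ler_wpM2r// ler_norm.
have Elb : has_lbound E by exists 0 => k [].
have sE x : N (D x) <= inf E * N x.
  have := N_ge0 x; rewrite le_eqVlt => /predU1P[Nx0|Nx].
    by have [k [_ /(_ x)]] := E0; rewrite -Nx0 !mulr0.
  rewrite -ler_pdivrMr//; apply: lb_le_inf => // k [_ /(_ x)].
  by rewrite ler_pdivrMr.
exists (inf E); split => //; first by apply: lb_le_inf => // k [].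
move=> e e0 s0.
have : ~ E (Num.max (inf E - e) 0).
  move=> /(ge_inf Elb); rewrite leNgt gt_max s0 andbT => /negP; apply.
  by rewrite ltrBlDr ltrDl.
move=> nE; have [x Dx] : exists x, ~ (N (D x) <= Num.max (inf E - e) 0 * N x).
  apply/existsNP => H; apply: nE; split => //.
  by rewrite le_max lexx orbT.
move/negP : Dx; rewrite -ltNge => Dx; exists x.
  rewrite lt_neqAle N_ge0 andbT eq_sym; apply: contraTneq Dx => Nx.
  by rewrite -leNgt Nx mulr0 (le_trans (sE x))// Nx mulr0.
apply: (le_trans _ (ltW Dx)); rewrite ler_wpM2r//.
by rewrite le_max lexx.
Qed.

(** With [D = P - Q] and [s = |D|^2], an almost maximizing vector
    [x] of [D] satisfies [D^2 x ~ s x], and so [<Q x, D^2 x>] is close to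
    [s <Q x, x>]; this is positive unless [s = 0], whereas
    [<Q x, D^2 x> = - <P D x, D x> <= 0]. *)
Theorem positive_square_root_unique (P Q : {linear V -> V}) (KP KQ c : R) :
  (forall x, cRe (dot (P x) (P x)) <= KP * cRe (dot x x)) ->
  (forall x, cRe (dot (Q x) (Q x)) <= KQ * cRe (dot x x)) ->
  (forall x, 0 <= dot (P x) x) ->
  0 < c -> (forall x, c%:C * dot x x <= dot (Q x) x) ->
  (forall x, dot (P (P x)) x = dot (Q (Q x)) x) ->
  forall x, P x = Q x.
Proof.
move=> bP bQ P0 c0 Qc PQ.
have Q0 x : 0 <= dot (Q x) x.
  by apply: le_trans (Qc x); rewrite mulr_ge0// ler0c ltW.
have imQ0 (z : R[i]) : 0 <= z -> cIm z = 0 by rewrite lecE => /andP[/eqP].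
have symP := real_form_symmetric (fun x => imQ0 _ (P0 x)).
have symQ := real_form_symmetric (fun x => imQ0 _ (Q0 x)).
have PPQQ x : P (P x) = Q (Q x).
  apply/eqP; rewrite -subr_eq0; apply/eqP/dot_eq0.
  pose B u v := dot (P (P u)) v - dot (Q (Q u)) v.
  have B0 u v : B u v = 0.
    apply: (@sesq_eq0 B) => [{}u u' {}v|{}u {}v v'|{}u {}v|{}u {}v|{}u]; rewrite /B.
    - by rewrite !raddfD !dotDl opprD addrACA.
    - by rewrite !dotDr opprD addrACA.
    - by rewrite !linearZ !dotZl mulrBr.
    - by rewrite !dotZr conjc_im mulrBr.
    - by rewrite PQ subrr.
  by rewrite dotBl; exact: B0.
pose D x := P x - Q x.
have PD x : P (D x) = - D (Q x).
  by rewrite /D linearB PPQQ opprB.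
have symD x y : ip (D x) y = ip x (D y).
  by rewrite ipBl ipBr /ip symP symQ.
have QDD x : ip (Q x) (D (D x)) <= 0.
  rewrite -symD -[D (Q x)]opprK -PD -scaleN1r -(rmorphN1 (real_complex R)).
  rewrite ipZl mulN1r oppr_le0.
  by have := P0 (D x); rewrite lecE => /andP[].
have DK x : N (D x) <= (2 * (KP + KQ)) * N x.
  have E : N (D x) + N (P x + Q x) = 2 * N (P x) + 2 * N (Q x).
    by rewrite /N /D ipBl !ipBr ipDl !ipDr (ipC (Q x) (P x)); ring.
  have := N_ge0 (P x + Q x).
  have : N (P x) <= KP * N x by exact: bP.
  have : N (Q x) <= KQ * N x by exact: bQ.
  lra.
have [s [s0 sub ssup]] := least_bound DK.
suff s_eq0 : s = 0.
  move=> x; apply/eqP; rewrite -subr_eq0; apply/eqP/N_eq0/eqP.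
  by rewrite eq_le N_ge0 andbT; have := sub x; rewrite s_eq0 mul0r.
apply/eqP/contraT => s_neq0; have {s_neq0}s0 : 0 < s by rewrite lt_neqAle eq_sym s_neq0.
(* The error allowed in the choice of x is such that each of the two terms of
   Young's inequality for <Q x, v>, with parameter d, is at most t / 2. *)
pose K := `|KQ| + 1; have K0 : 0 < K by rewrite ltr_wpDl.
pose d := s * c / (2 * K).
have d0 : 0 < d by rewrite divr_gt0// mulr_gt0.
have e0 : 0 < c * d / 2 by rewrite divr_gt0// mulr_gt0.
have [x Nx Dx] := ssup _ e0 s0.
pose v := D (D x) - s%:C *: x.
have Nv : N v <= s * (c * d / 2) * N x.
  (* N v = N (D D x) - 2 s N (D x) + s^2 N x, where N (D D x) <= s N (D x). *)
  have := sub (D x).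
  have -> : N v = N (D (D x)) - 2 * s * N (D x) + s * (s * N x).
    by rewrite /v N_subZ symD.
  nra.
have Qv : ip (Q x) v <= - (s * (c * N x)).
  rewrite ipBr ipZr.
  have : c * N x <= ip (Q x) x.
    have := Qc x; rewrite lecE => /andP[_]; rewrite /N /ip.
    by case: (dot x x) => p q /=; rewrite mul0r subr0; apply.
  move=> cQ; have := QDD x; nra.
have NQ : N (Q x) <= K * N x.
  apply: le_trans (bQ x) _; rewrite ler_wpM2r ?N_ge0//.
  by rewrite /K (le_trans (ler_norm _))// lerDl.
pose t := s * c * N x; have t0 : 0 < t by rewrite !mulr_gt0.
have H1 : d * N (Q x) <= t / 2.
  have -> : t / 2 = d * (K * N x) by rewrite /t /d; field; rewrite gt_eqF.
  by rewrite ler_wpM2l// ltW.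
have H2 : d^-1 * N v <= t / 2.
  have -> : t / 2 = d^-1 * (s * (c * d / 2) * N x).
    by rewrite /t; field; rewrite gt_eqF.
  by rewrite ler_wpM2l// invr_ge0 ltW.
have H3 : ip (Q x) v <= - t by rewrite /t -mulrA; exact: Qv.
have := ip_young (Q x) v d0; lra.
Qed.
End SquareRoot.

(** * Increasing changes of variables on the line *)

Section Density.
Local Open Scope ereal_scope.
Context d (T : measurableType d) (R : realType).
Variables (mu : {measure set T -> \bar R}) (f : T -> R).

Definition with_density (mf : measurable_fun setT f) (f0 : forall x, (0 <= f x)%R) :
  set T -> \bar R := fun A => \int[mu]_(x in A) (f x)%:E.

Hypotheses (mf : measurable_fun setT f) (f0 : forall x, (0 <= f x)%R).
Local Notation nu := (with_density mf f0).

Let nu0 : nu set0 = 0.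
Proof. exact: integral_set0. Qed.

Let nu_ge0 A : 0 <= nu A.
Proof. by apply: integral_ge0 => x _; rewrite lee_fin. Qed.

Let nu_sigma_additive : semi_sigma_additive nu.
Proof.
move=> /= F mF tF mUF; rewrite /with_density; apply: cvg_toP.
  apply: ereal_nondecreasing_is_cvgn => m n mn.
  by apply: lee_sum_nneg_natr => // k _ _; exact: nu_ge0.
rewrite ge0_integral_bigcup//=.
- by apply: measurable_funTS; exact/measurable_EFinP.
- by move=> x _; rewrite lee_fin.
Qed.

HB.instance Definition _ := isMeasure.Build _ _ _ nu nu0 nu_ge0 nu_sigma_additive.

Import HBNNSimple.

Let integral_density_nnsfun (h : {nnsfun T >-> R}) :
  \int[nu]_x (h x)%:E = \int[mu]_x ((h x)%:E * (f x)%:E).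
Proof.
have hE x : (h x)%:E * (f x)%:E =
    \sum_(r \in range h) (r * \1_(h @^-1` [set r]) x)%:E * (f x)%:E.
  rewrite -ge0_mule_fsuml => [|y]; last exact: nnfun_muleindic_ge0.
  by rewrite fsumEFin // -(fimfunE _ x).
under [RHS]eq_integral do rewrite hE.
under [LHS]eq_integral do rewrite fimfunE -fsumEFin//.
rewrite [LHS]ge0_integral_fsum//; last 2 first.
  - by move=> r; exact/measurable_EFinP/measurableT_comp.
  - by move=> n x _; rewrite EFinM nnfun_muleindic_ge0.
rewrite [RHS]ge0_integral_fsum//; last 2 first.
  - move=> r; apply: emeasurable_funM; last exact/measurable_EFinP.
    exact/measurable_EFinP/measurableT_comp.
  - by move=> n x _; rewrite mule_ge0 ?lee_fin// -lee_fin EFinM nnfun_muleindic_ge0.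
apply: eq_fsbigr => r; rewrite inE => -[t _ <-].
rewrite integralZl_indic_nnsfun// integral_indic//= setIT.
under [RHS]eq_integral do rewrite EFinM -muleA.
rewrite ge0_integralZl//.
- congr (_ * _); rewrite /with_density [LHS]integral_mkcond.
  by apply: eq_integral => x _; rewrite epatch_indic muleC.
- by apply: emeasurable_funM; exact/measurable_EFinP.
- by move=> x _; rewrite mule_ge0 ?lee_fin.
- by rewrite lee_fin.
Qed.

(** True for indicators by definition, hence for simple functions by linearity,
    and for nonnegative functions by monotone convergence. *)
Lemma ge0_integral_with_density (h : T -> \bar R) :
  measurable_fun setT h -> (forall x, 0 <= h x) ->
  \int[nu]_x h x = \int[mu]_x (h x * (f x)%:E).
Proof.
move=> mh h0.
pose g := nnsfun_approx measurableT mh.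
have gh x : (g n x)%:E @[n --> \oo] --> h x by exact: cvg_nnsfun_approx.
transitivity (lim (\int[nu]_x (g n x)%:E @[n --> \oo])).
  rewrite -monotone_convergence//=.
  - by apply: eq_integral => x _; exact/esym/cvg_lim.
  - by move=> n; exact/measurable_EFinP.
  - by move=> n x _; rewrite lee_fin.
  - by move=> x _ m n mn; rewrite lee_fin; exact/lefP/nd_nnsfun_approx.
rewrite (_ : (fun n => _) = fun n => \int[mu]_x ((g n x)%:E * (f x)%:E)); last first.
  by apply/funext => n; exact: integral_density_nnsfun.
rewrite -monotone_convergence//=.
- apply: eq_integral => x _; apply/cvg_lim => //.
  by apply: cvgeZr => //; exact: gh.
- by move=> n; apply: emeasurable_funM; exact/measurable_EFinP.
- by move=> n x _; rewrite mule_ge0 ?lee_fin.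
- move=> x _ m n mn; rewrite lee_wpmul2r ?lee_fin//.
  exact/lefP/nd_nnsfun_approx.
Qed.

End Density.

Section ChangeOfVariables.
Context {R : realType}.
Local Notation mu := (@lebesgue_measure R).
Variables F f : R -> R.
Hypotheses (F_incr : {homo F : x y / x < y}) (dF : forall x, is_derive x (1 : R) F (f x)).
Hypotheses (cF' : continuous f) (F_surj : forall y, exists x, F x = y).

Let cF : continuous F.
Proof. by move=> x; exact/differentiable_continuous/derivable1_diffP. Qed.

Let mF : measurable_fun setT (F : measurableTypeR R -> measurableTypeR R).
Proof. exact: continuous_measurable_fun. Qed.

Let mF' : measurable_fun setT (f : measurableTypeR R -> R).
Proof. exact: continuous_measurable_fun. Qed.

Let F'_ge0 x : 0 <= f x.
Proof.
have [_ <-] := dF x; rewrite -derive1E; apply: (@incr_derive1_ge0 _ _ setT) => //.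
- by move=> ? ? _ _; exact: F_incr.
- by rewrite interiorT.
Qed.

Let F_mono : {mono F : x y / x <= y}.
Proof. exact: le_mono. Qed.

(** The right-hand side is a measure in [A]; on half-open intervals it agrees
    with Lebesgue measure by the fundamental theorem of calculus, and Lebesgue
    measure is determined by its values there. *)
Lemma increasing_lebesgue_measure (A : set R) : measurable A ->
  mu A = (\int[mu]_(x in F @^-1` A) (f x)%:E)%E.
Proof.
move=> mA.
pose nu : {measure set _ -> \bar R} := with_density mu mF' F'_ge0.
pose rho : {measure set _ -> \bar R} := pushforward nu (F : _ -> measurableTypeR R).
suff : mu A = rho mF A by [].
apply: lebesgue_measure_unique => // _ [[a b]] _ <- /=.
have [ab|ba] := ltP a b; last first.
  rewrite set_itv_ge ?bnd_simp -?leNgt//.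
  by rewrite !measure0.
have [u Fu] := F_surj a; have [v Fv] := F_surj b.
have uv : u < v by rewrite -(leW_mono F_mono) Fu Fv.
rewrite /rho/= /pushforward/= /nu /with_density.
have -> : F @^-1` `]a, b] = `]u, v]%classic.
  apply/seteqP; split => x /=; rewrite !in_itv/= -Fu -Fv;
  by rewrite (leW_mono F_mono) F_mono.
rewrite lebesgue_measure_itv/= lte_fin ab integral_itv_obnd_cbnd; last first.
  by apply/measurable_funTS/measurable_EFinP.
rewrite (@continuous_FTC2 _ f F) ?Fu ?Fv//.
- exact: continuous_subspaceT.
- split => [x _||].
  + exact: ex_derive.
  + by apply: cvg_at_right_filter; exact: cF.
  + by apply: cvg_at_left_filter; exact: cF.
- by move=> x _; rewrite derive1E; have [_ ->] := dF x.
Qed.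

(** By the previous lemma, Lebesgue measure is the image under [F] of the
    measure with density [f]. *)
Lemma increasing_change_of_variables (D : set R) (h : R -> \bar R) :
  measurable D -> measurable_fun setT h -> (forall y, 0 <= h y)%E ->
  (\int[mu]_(y in D) h y = \int[mu]_(x in F @^-1` D) (h (F x) * (f x)%:E))%E.
Proof.
move=> mD mh h0.
pose nu : {measure set _ -> \bar R} := with_density mu mF' F'_ge0.
have mFD : measurable (F @^-1` D) by rewrite -[X in measurable X]setTI; exact: mF.
pose rho : {measure set _ -> \bar R} := pushforward nu (F : _ -> measurableTypeR R).
transitivity (\int[rho mF]_(y in D) h y)%E.
  by apply: eq_measure_integral => A mA _; exact: (increasing_lebesgue_measure mA).
rewrite /rho.
rewrite ge0_integral_pushforward//=; last exact: measurable_funTS.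
rewrite integral_mkcond ge0_integral_with_density//; first last.
- by move=> x; rewrite erestrict_ge0// => ? _; exact: h0.
- apply/(measurable_restrictT _ _).1 => //; apply: measurable_funTS.
  exact: measurableT_comp.
rewrite [RHS]integral_mkcond; apply: eq_integral => x _.
by rewrite !patchE; case: ifPn => //; rewrite mul0e.
Qed.

End ChangeOfVariables.

(** * The angular lift of a Moebius map *)

Section Lift.
Context {R : realType}.
Variable a : disc R.
Let a1 := cRe (disc_val a).
Let a2 := cIm (disc_val a).
Implicit Types t : R.

Let a_lt1 : a1 ^+ 2 + a2 ^+ 2 < 1.
Proof.
rewrite -normc_sqr expr_lte1// ?normc_ge0//.
by rewrite -normc_lt1; exact: disc_lt1.
Qed.

Let u t := 1 - (a1 * cos t + a2 * sin t).
Let v t := a2 * cos t - a1 * sin t.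

Let denE t : 1 - conjc a * expi t = u t +i* v t.
Proof.
rewrite /u /v /a1 /a2; case: (disc_val a) => p q /=.
by apply/eqP; rewrite eq_complex /=; apply/andP; split; apply/eqP; ring.
Qed.

Let u_gt0 t : 0 < u t.
Proof.
have := cos2Dsin2 t; have := sqr_ge0 (a1 * sin t - a2 * cos t).
set c := cos t; set s := sin t; rewrite /u -/c -/s => H1 H2.
have H3 : (a1 * c + a2 * s) ^+ 2 < 1.
  apply: le_lt_trans a_lt1; nra.
nra.
Qed.

(** With [v = 1 - conj a z] and [z = exp (i t)], one has
    [phi_a z = - z * conj v / v], and [conj v / v = exp (- 2 i arg v)] where
    [arg v] is an arctangent because [Re v > 0]. *)
Definition mobius_lift t := t + pi - 2 * atan (v t / u t).

(** The modulus of the derivative of [phi_a] at a point of the circle. *)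
Definition mobius_jacobian (z : circle R) : R :=
  (1 - normc a ^+ 2) / normc (1 - conjc a * z) ^+ 2.

Let jacE t : mobius_jacobian (expi t) = (1 - (a1 ^+ 2 + a2 ^+ 2)) / (u t ^+ 2 + v t ^+ 2).
Proof. by rewrite /mobius_jacobian denE !normc_sqr. Qed.

Let uv_gt0 t : 0 < u t ^+ 2 + v t ^+ 2.
Proof. by rewrite ltr_wpDr ?sqr_ge0// exprn_gt0. Qed.

Lemma mobius_jacobian_expi_gt0 t : 0 < mobius_jacobian (expi t).
Proof. by rewrite jacE divr_gt0// subr_gt0. Qed.

(** With [v = U + i V], the derivative is [1 - 2 (V' U - V U') / |v|^2], where
    [V' = U - 1] and [U' = - V].  The numerator over [|v|^2] is
    [2 U - U^2 - V^2 = 1 - |v - 1|^2 = 1 - |a|^2]. *)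
Lemma is_derive_mobius_lift t :
  is_derive t (1 : R) mobius_lift (mobius_jacobian (expi t)).
Proof.
have u0 : u t != 0 by rewrite gt_eqF.
have uv0 : u t ^+ 2 + v t ^+ 2 != 0 by rewrite gt_eqF.
have du : is_derive t (1 : R) u (- (a1 * - sin t + a2 * cos t)).
  by rewrite /u; apply: is_derive_eq; rewrite /GRing.scale/=; ring.
have dv : is_derive t (1 : R) v (a2 * - sin t - a1 * cos t).
  by rewrite /v; apply: is_derive_eq; rewrite /GRing.scale/=; ring.
have dq : is_derive t (1 : R) (fun s => v s / u s)
    (((a2 * - sin t - a1 * cos t) * u t - v t * - (a1 * - sin t + a2 * cos t)) / u t ^+ 2).
  have dV := is_deriveV u0 du.
  apply: (is_derive_eq (is_deriveM dv dV)); rewrite /GRing.scale/=; field.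
  exact: u0.
have dA : is_derive t (1 : R) (atan \o (fun s => v s / u s))
    ((1 + (v t / u t) ^+ 2)^-1 *
     (((a2 * - sin t - a1 * cos t) * u t - v t * - (a1 * - sin t + a2 * cos t)) /
      u t ^+ 2)).
  exact: is_derive1_comp.
rewrite /mobius_lift jacE; apply: is_derive_eq.
have := cos2Dsin2 t; rewrite /u /v in u0 uv0 *; move: u0 uv0.
set c := cos t; set s := sin t => u0 uv0 cs.
set U := (X in X != 0) in u0; set V := a2 * c - a1 * s in uv0 *.
have -> : (1 + (V / U) ^+ 2)^-1 = U ^+ 2 / (U ^+ 2 + V ^+ 2).
  by field; rewrite uv0 u0.
have -> : a1 ^+ 2 + a2 ^+ 2 = (1 - U) ^+ 2 + V ^+ 2.
  transitivity ((a1 ^+ 2 + a2 ^+ 2) * (c ^+ 2 + s ^+ 2)); first by rewrite cs mulr1.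
  by rewrite /U /V; ring.
rewrite /GRing.scale/= (_ : a2 * - s - a1 * c = U - 1); last by rewrite /U; ring.
rewrite (_ : a1 * - s + a2 * c = V); last by rewrite /V; ring.
by rewrite -/U; field; rewrite uv0 u0.
Qed.

Lemma mobius_lift_incr : {homo mobius_lift : x y / x < y}.
Proof.
move=> x y xy.
have dlift z : z \in `]x, y[ -> is_derive z (1 : R) mobius_lift (mobius_jacobian (expi z)).
  by move=> _; exact: is_derive_mobius_lift.
have clift : {within `[x, y], continuous mobius_lift}.
  apply: derivable_within_continuous => z _.
  by have [] := is_derive_mobius_lift z.
have [z _ E] := MVT xy dlift clift.
by rewrite -subr_gt0 E mulr_gt0 ?subr_gt0// mobius_jacobian_expi_gt0.
Qed.

Lemma continuous_mobius_jacobian_expi :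
  continuous (fun t : R => mobius_jacobian (expi t)).
Proof.
have cu : continuous u.
  move=> t; apply: cvgB; first exact: cvg_cst.
  by apply: cvgD; apply: cvgM; [exact: cvg_cst|exact: continuous_cos
    |exact: cvg_cst|exact: continuous_sin].
have cv : continuous v.
  move=> t.
  by apply: cvgB; apply: cvgM; [exact: cvg_cst|exact: continuous_cos
    |exact: cvg_cst|exact: continuous_sin].
move=> t; rewrite (_ : (fun t : R => _) =
  fun t => (1 - (a1 ^+ 2 + a2 ^+ 2)) / (u t ^+ 2 + v t ^+ 2)); last exact/funext/jacE.
apply: cvgM; first exact: cvg_cst.
apply: cvgV; first by rewrite gt_eqF.
by apply: cvgD; apply: cvgM; [exact: cu|exact: cu|exact: cv|exact: cv].
Qed.

(** The arctangent lies between [- pi / 2] and [pi / 2], so that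
    [t < mobius_lift t < t + 2 pi]; the intermediate value theorem applies. *)
Lemma mobius_lift_surj y : exists t, mobius_lift t = y.
Proof.
have pi_pos := @pi_gt0 R.
have lo t : t < mobius_lift t.
  by have := atan_ltpi2 (v t / u t); rewrite /mobius_lift; lra.
have hi t : mobius_lift t < t + 2 * pi.
  by have := atan_gtNpi2 (v t / u t); rewrite /mobius_lift; lra.
have clift : {within `[y - 2 * pi, y], continuous mobius_lift}.
  apply: derivable_within_continuous => z _.
  by have [] := is_derive_mobius_lift z.
have [||t _ <-] := @IVT _ mobius_lift (y - 2 * pi) y y _ clift; last by exists t.
  lra.
have := lo y; have := hi (y - 2 * pi); rewrite subrK => H1 H2.
by rewrite ge_min le_max (ltW H1) (ltW H2) orbT.
Qed.

Lemma mobius_liftD2pi t : mobius_lift (t + pi *+ 2) = mobius_lift t + pi *+ 2.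
Proof.
rewrite /mobius_lift (_ : v (t + pi *+ 2) = v t); last by rewrite /v cosD2pi sinD2pi.
rewrite (_ : u (t + pi *+ 2) = u t); last by rewrite /u cosD2pi sinD2pi.
ring.
Qed.

Lemma mobius_expi t : mobius_circle a (expi t) = expi (mobius_lift t).
Proof.
apply: val_inj => /=; rewrite /mobius [1 - _]denE.
have u0 : u t != 0 by rewrite gt_eqF.
have uv0 : u t ^+ 2 + v t ^+ 2 != 0 by rewrite gt_eqF.
have den0 : u t +i* v t != 0 by rewrite eq_complex/= negb_and u0.
apply: (mulIf den0); rewrite divfK//.
set b := atan (v t / u t).
have b2 : cos b ^+ 2 = u t ^+ 2 / (u t ^+ 2 + v t ^+ 2).
  rewrite cos_atan exprVn sqr_sqrtr; last by rewrite addr_ge0// sqr_ge0.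
  by field; rewrite uv0 u0.
have cosb0 : cos b != 0.
  by rewrite gt_eqF// cos_gt0_pihalf// atan_gtNpi2 atan_ltpi2.
have sb : sin b = v t / u t * cos b.
  by rewrite -[v t / u t]atanK -/b /tan divfK.
have C2 : cos (2 * b) = (u t ^+ 2 - v t ^+ 2) / (u t ^+ 2 + v t ^+ 2).
  rewrite mulr_natl mulr2n cosD sb -!expr2 exprMn b2.
  by field; rewrite uv0 u0.
have S2 : sin (2 * b) = 2 * u t * v t / (u t ^+ 2 + v t ^+ 2).
  rewrite mulr_natl mulr2n sinD sb (_ : _ + _ = 2 * (v t / u t) * cos b ^+ 2); last by ring.
  by rewrite b2; field; rewrite uv0 u0.
rewrite /mobius_lift -/b (_ : t + pi - 2 * b = t - 2 * b + pi); last by ring.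
rewrite cosDpi sinDpi cosB sinB C2 S2.
have := cos2Dsin2 t; rewrite /u /v in u0 uv0 *; move: u0 uv0.
rewrite (_ : disc_val a = a1 +i* a2); last by rewrite /a1 /a2; case: (disc_val a).
move: (a1) (a2) (cos t) (sin t) => p q c s u0 uv0 cs.
apply/eqP; rewrite eq_complex/=.
set U := 1 - _ in u0 uv0 *; set V := q * c - p * s in uv0 *.
apply/andP; split; apply/eqP.
  transitivity (- (c * U + s * V)); last by field.
  transitivity (p * (c ^+ 2 + s ^+ 2) - c); first by rewrite cs mulr1.
  by rewrite /U /V; ring.
transitivity (c * V - s * U); last by field.
transitivity (q * (c ^+ 2 + s ^+ 2) - s); first by rewrite cs mulr1.
by rewrite /U /V; ring.
Qed.

End Lift.

(** * Periodic integrals and complex measurability *)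

Section Periodic.
Context {R : realType}.
Local Notation leb := (@lebesgue_measure R).

(** The piece of the integral over [p, c + p] is moved back to [0, c] by a
    translation. *)
Lemma integral_periodic (h : R -> \bar R) (p c : R) :
  measurable_fun setT h -> (forall x, 0 <= h x)%E -> (forall x, h (x + p)%R = h x) ->
  0 <= c <= p ->
  (\int[leb]_(x in `[c, (c + p)%R]) h x = \int[leb]_(x in `[0%R, p]) h x)%E.
Proof.
move=> mh h0 hp /andP[c0 cp].
have split (x y z : R) : x <= y -> y <= z ->
    (\int[leb]_(t in `[x, z]) h t
     = \int[leb]_(t in `]x, y]) h t + \int[leb]_(t in `]y, z]) h t)%E.
  move=> xy yz; rewrite -integral_itv_obnd_cbnd; last exact: measurable_funTS.
  rewrite (@itv_bndbnd_setU _ _ _ (BRight y)) ?bnd_simp//.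
  rewrite ge0_integral_setU//; first exact: measurable_funTS.
  rewrite disj_set2E; apply/eqP; rewrite -subset0 => t /=.
  by rewrite !in_itv/= => -[/andP[_ ty] /andP[]]; rewrite ltNge ty.
rewrite (split c p (c + p)) ?lerDr// (split 0 c p)// addeC; congr (_ + _)%E.
have shift_derive (x : R) : is_derive x (1 : R) (fun t => t + p) 1.
  by apply: is_derive_eq; rewrite addr0.
rewrite (@increasing_change_of_variables _ (fun t => t + p) (cst 1)) => //.
- have -> : (fun t => t + p) @^-1` `]p, c + p] = `]0, c]%classic.
    by apply/seteqP; split => x /=; rewrite !in_itv/= lerD2r ltrDr.
  by apply: eq_integral => x _; rewrite hp mule1.
- by move=> x y; rewrite ltrD2r.
- by move=> x; exact: cvg_cst.
- by move=> y; exists (y - p); rewrite subrK.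
Qed.

End Periodic.

Section ComplexMeasurable.
Context d (T : measurableType d) {R : realType}.
Implicit Types f g : T -> R[i].

(** Borel measurability of a complex function, in the coordinates used by
    [square_integrable]. *)
Definition cmeasurable f :=
  measurable_fun setT (cRe \o f) /\ measurable_fun setT (cIm \o f).

Lemma cmeasurable_cst (c : R[i]) : cmeasurable (fun=> c).
Proof. by split; exact: measurable_cst. Qed.

Lemma cmeasurable_sub f g :
  cmeasurable f -> cmeasurable g -> cmeasurable (fun x => f x - g x).
Proof.
move=> [fR fI] [gR gI]; split.
  rewrite (_ : _ \o _ = fun x => cRe (f x) - cRe (g x)); first exact: measurable_funB.
  by apply/funext => x /=; case: (f x) (g x) => [? ?] [].
rewrite (_ : _ \o _ = fun x => cIm (f x) - cIm (g x)); first exact: measurable_funB.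
by apply/funext => x /=; case: (f x) (g x) => [? ?] [].
Qed.

Lemma cmeasurable_mul f g :
  cmeasurable f -> cmeasurable g -> cmeasurable (fun x => f x * g x).
Proof.
move=> [fR fI] [gR gI]; split.
  rewrite (_ : _ \o _ = fun x => cRe (f x) * cRe (g x) - cIm (f x) * cIm (g x)).
    by apply: measurable_funB; apply: measurable_funM.
  by apply/funext => x /=; case: (f x) (g x) => [? ?] [].
rewrite (_ : _ \o _ = fun x => cRe (f x) * cIm (g x) + cIm (f x) * cRe (g x)).
  by apply: measurable_funD; apply: measurable_funM.
by apply/funext => x /=; case: (f x) (g x) => [? ?] [].
Qed.

Lemma cmeasurable_normc_sqr f :
  cmeasurable f -> measurable_fun setT (fun x => normc (f x) ^+ 2).
Proof.
move=> [fR fI]; under eq_fun do rewrite normc_sqr.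
by apply: measurable_funD; exact: measurable_funX.
Qed.

Lemma measurable_fun_inv_ge0 (f : T -> R) : (forall x, 0 <= f x) ->
  measurable_fun setT f -> measurable_fun setT (fun x => (f x)^-1).
Proof.
move=> f0 mf; under eq_fun do rewrite -powR_inv1//.
exact: (measurableT_comp (measurable_powR _) mf).
Qed.

Lemma cmeasurable_inv f : cmeasurable f -> cmeasurable (fun x => (f x)^-1).
Proof.
move=> mf; have mV := measurable_fun_inv_ge0
  (fun x => sqr_ge0 (normc (f x))) (cmeasurable_normc_sqr mf).
have [fR fI] := mf; split.
  rewrite (_ : _ \o _ = fun x => cRe (f x) * (normc (f x) ^+ 2)^-1).
    exact: measurable_funM.
  by apply/funext => x /=; rewrite normc_sqr; case: (f x).
rewrite (_ : _ \o _ = fun x => - (cIm (f x) * (normc (f x) ^+ 2)^-1)).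
  by apply: measurableT_comp => //; exact: measurable_funM.
by apply/funext => x /=; rewrite normc_sqr; case: (f x).
Qed.

Lemma measurable_circle (f : T -> circle R) :
  measurable_fun setT f <-> cmeasurable (fun x => circle_val (f x)).
Proof.
have mcoord : measurable_fun setT (@circle_coord R).
  by move=> _ Y mY; rewrite setTI; exists Y => //; rewrite setTI.
split=> [mf|[fR fI]].
  have mc : measurable_fun setT (@circle_coord R \o f) by exact: measurableT_comp.
  split.
    exact: (measurableT_comp (@measurable_fst _ _ _ _) mc).
  exact: (measurableT_comp (@measurable_snd _ _ _ _) mc).
move=> _ _ [B mB <-]; rewrite !setTI -comp_preimage -[X in measurable X]setTI.
have : measurable_fun setT (@circle_coord R \o f) by exact: measurable_fun_pair.
by apply.
Qed.

End ComplexMeasurable.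

(** * Moebius maps and arc length *)

Section MobiusMeasure.
Context {R : realType}.
Local Notation mu := (@arc_measure R).
Local Notation leb := (@lebesgue_measure R).
Implicit Types (a : disc R) (z : circle R).

Lemma cmeasurable_circle_val : cmeasurable (@circle_val R).
Proof. by apply/measurable_circle; exact: measurable_id. Qed.

Lemma cmeasurable_den a : cmeasurable (fun z => 1 - conjc a * circle_val z).
Proof.
apply: cmeasurable_sub; first exact: cmeasurable_cst.
by apply: cmeasurable_mul; [exact: cmeasurable_cst|exact: cmeasurable_circle_val].
Qed.

Lemma measurable_mobius_circle a : measurable_fun setT (mobius_circle a).
Proof.
apply/measurable_circle; apply: cmeasurable_mul; last first.
  exact/cmeasurable_inv/cmeasurable_den.
by apply: cmeasurable_sub; [exact: cmeasurable_cst|exact: cmeasurable_circle_val].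
Qed.

Lemma den_circle_neq0 a z : 1 - conjc a * circle_val z != 0.
Proof.
rewrite subr_eq0; apply/negP => /eqP/(congr1 Num.norm).
rewrite normr1 normrM normcJ (eqP (circle_eq1 z)) mulr1 => E.
by have := disc_lt1 a; rewrite -E ltxx.
Qed.

Lemma den_circle_gt0 a z : 0 < normc (1 - conjc a * circle_val z).
Proof. by rewrite -ltcR -normcR normr_gt0 den_circle_neq0. Qed.

Lemma onem_normc_sqr_gt0 a : 0 < 1 - normc a ^+ 2.
Proof.
by rewrite subr_gt0 expr_lte1// ?normc_ge0// -normc_lt1; exact: disc_lt1.
Qed.

Lemma mobius_jacobian_gt0 a z : 0 < mobius_jacobian a z.
Proof. by rewrite divr_gt0 ?exprn_gt0 ?den_circle_gt0 ?onem_normc_sqr_gt0. Qed.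

Lemma measurable_mobius_jacobian a : measurable_fun setT (mobius_jacobian a).
Proof.
apply: measurable_funM; first exact: measurable_cst.
apply: measurable_fun_inv_ge0 => [z|]; first exact: sqr_ge0.
exact/cmeasurable_normc_sqr/cmeasurable_den.
Qed.

Lemma ge0_integral_arc_measure (g : circle R -> \bar R) :
  measurable_fun setT g -> (forall z, 0 <= g z)%E ->
  (\int[mu]_z g z = (pi *+ 2)^-1%:E * \int[leb]_(t in `[0%R, (pi *+ 2)%R]) g (expi t))%E.
Proof.
move=> mg g0; rewrite ge0_integral_distribution// integral_uniform//; first last.
- by move=> t; exact: g0.
- exact: (measurableT_comp mg (@measurable_expi R)).
by rewrite subr0.
Qed.

(** In the angle [t], the left-hand side is the integral of the periodic
    function [g (exp (i s))] over the image of [0, 2 pi] under [mobius_lift],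
    which is an interval of length [2 pi]. *)
Lemma ge0_integral_mobius_jacobian a (g : circle R -> \bar R) :
  measurable_fun setT g -> (forall z, 0 <= g z)%E ->
  (\int[mu]_z (g (mobius_circle a z) * (mobius_jacobian a z)%:E) = \int[mu]_z g z)%E.
Proof.
move=> mg g0; rewrite !ge0_integral_arc_measure//; first last.
- by move=> z; rewrite mule_ge0// lee_fin ltW// mobius_jacobian_gt0.
- apply: emeasurable_funM; last by apply/measurable_EFinP; exact: measurable_mobius_jacobian.
  exact: (measurableT_comp mg (measurable_mobius_circle a)).
congr (_ * _)%E.
pose h (t : R) := g (expi t).
have mh : measurable_fun setT h by exact: (measurableT_comp mg (@measurable_expi R)).
have hp t : h (t + pi *+ 2) = h t.
  by congr g; apply: val_inj; rewrite /= cosD2pi sinD2pi.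
have [l0 l2] : 0 <= mobius_lift a 0 /\ mobius_lift a 0 <= pi *+ 2.
  have := pi_gt0 R; rewrite /mobius_lift; set A := atan _.
  have : - (pi / 2) < A by exact: atan_gtNpi2.
  have : A < pi / 2 by exact: atan_ltpi2.
  by move=> ? ? ?; split; lra.
rewrite -[RHS](integral_periodic (h := h) (c := mobius_lift a 0)) ?l0//.
have mono : {mono mobius_lift a : x y / x <= y} by exact/le_mono/mobius_lift_incr.
rewrite [RHS](increasing_change_of_variables (@mobius_lift_incr R a)
   (@is_derive_mobius_lift R a) (@continuous_mobius_jacobian_expi R a)
   (@mobius_lift_surj R a))//.
  have -> : mobius_lift a @^-1` `[mobius_lift a 0, mobius_lift a 0 + pi *+ 2] =
      `[0, pi *+ 2]%classic.
    apply/seteqP; split => x /=; rewrite !in_itv/= mono;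
    by rewrite -[X in mobius_lift a X + _]/0 -mobius_liftD2pi add0r mono.
  by apply: eq_integral => t _; rewrite mobius_expi.
- by move=> y; exact: g0.
- by move=> y; exact: g0.
Qed.

Lemma mobiusE (a z : R[i]) : mobius a z = (a - z) / (1 - conjc a * z).
Proof. by []. Qed.

Lemma conjcM_normc (a : R[i]) : conjc a * a = (normc a ^+ 2)%:C.
Proof. by rewrite mulrC -sqr_normc normcR rmorphXn. Qed.

Lemma onem_conjcM a : 1 - conjc a * disc_val a = (1 - normc a ^+ 2)%:C.
Proof. by rewrite conjcM_normc rmorphB rmorph1. Qed.

Lemma onem_conjcM_neq0 a : 1 - conjc a * disc_val a != 0.
Proof.
rewrite onem_conjcM -(rmorph0 (real_complex R)).
by rewrite (inj_eq (@complexI R)) gt_eqF ?onem_normc_sqr_gt0.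
Qed.

Lemma mobius_circleK a : involutive (mobius_circle a).
Proof.
move=> z; apply: val_inj; rewrite /= !mobiusE.
have := den_circle_neq0 a z; have := onem_conjcM_neq0 a.
move: (circle_val z) (disc_val a) => w b.
set b' := b^*%C; move: b' => b' H1 H2.
field; rewrite H2/=; apply: contra H1 => /eqP <-; apply/eqP; ring.
Qed.

Lemma den_mobius_circle a z :
  normc (1 - conjc a * mobius_circle a z)
  = (1 - normc a ^+ 2) / normc (1 - conjc a * circle_val z).
Proof.
have -> : 1 - conjc a * mobius_circle a z =
    (1 - conjc a * disc_val a) / (1 - conjc a * circle_val z).
  by rewrite /= mobiusE; have := den_circle_neq0 a z; move=> H; field.
rewrite normcM normcV onem_conjcM; congr (_ / _).
by rewrite /= expr0n/= addr0 sqrtr_sqr gtr0_norm// onem_normc_sqr_gt0.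
Qed.

Lemma mobius_jacobianM a z :
  mobius_jacobian a (mobius_circle a z) * mobius_jacobian a z = 1.
Proof.
rewrite /mobius_jacobian den_mobius_circle.
have := den_circle_gt0 a z; have := onem_normc_sqr_gt0 a.
by set n := 1 - _ => /lt0r_neq0 n0 /lt0r_neq0 d0; field; rewrite n0 d0.
Qed.

(** The real number [s] is [sqrt (1 - |a|^2)].  Its reality is what allows the
    two relations to be conjugated in [mobius_omega]. *)
Lemma conjc_omega a :
  exists2 s : R, 0 < s & conjc a * disc_val (omega a) = 1 - s%:C /\
    disc_val a - disc_val (omega a) = s%:C * disc_val (omega a).
Proof.
exists (Num.sqrt (1 - normc a ^+ 2)); first by rewrite sqrtr_gt0 onem_normc_sqr_gt0.
have E : conjc a * disc_val (omega a) = 1 - (Num.sqrt (1 - normc a ^+ 2))%:C.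
  rewrite /= /fixpoint; case: eqP => [->|/eqP a0].
    by rewrite mulr0 normc0 expr0n/= subr0 sqrtr1 subrr.
  by rewrite mulrC divfK// conjc_eq0.
split=> //; have /mobius_fixedE H := omega_fixed a.
rewrite H mulrC; congr (_ * _).
by rewrite [_^* * _]E opprB addrCA subrr addr0.
Qed.

(** Both sides equal [(omega + z) / (1 + conj omega z)]: a factor [s] comes out
    of the numerator and of the denominator of the left-hand side. *)
Lemma mobius_omega a z :
  mobius_circle a (mobius_circle (omega a) z) =
  mobius_circle (omega a) (circle_opp z).
Proof.
apply: val_inj; rewrite [LHS]mobiusE [RHS]mobiusE [circle_val (mobius_circle _ z)]mobiusE.
have [s s0 [E1 E2]] := conjc_omega a.
have D1 := den_circle_neq0 (omega a) z.
have D2 := den_circle_neq0 (omega a) (circle_opp z).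
move: E1 E2 D1 D2; rewrite [circle_val (circle_opp z)]/=.
move: (disc_val (omega a)) (disc_val a) (circle_val z) => w b y E1 E2 D1 D2.
have sJ : conjc s%:C = s%:C by apply/eqP; rewrite eq_complex/= oppr0 !eqxx.
have sC : s%:C != 0.
  by rewrite -(rmorph0 (real_complex R)) (inj_eq (@complexI R)) gt_eqF.
have E1' : b * conjc w = 1 - s%:C.
  by rewrite -[s%:C]sJ -[1]conjc1 -rmorphB -E1 rmorphM/= conjcK.
have E2' : conjc b - conjc w = s%:C * conjc w.
  by rewrite -[s%:C]sJ -rmorphM -E2 rmorphB.
move: (conjc w) (conjc b) (s%:C) E1 E2 E1' E2' D1 D2 sC => w' b' t E1 E2 E1' E2' D1 D2 t0.
have N : b - (w - y) / (1 - w' * y) = t * (w + y) / (1 - w' * y).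
  transitivity ((b - w + y * (1 - b * w')) / (1 - w' * y)); first by field.
  by rewrite E2 E1'; field.
have D : 1 - b' * ((w - y) / (1 - w' * y)) = t * (1 + w' * y) / (1 - w' * y).
  transitivity ((1 - b' * w + y * (b' - w')) / (1 - w' * y)); first by field.
  by rewrite E1 E2'; field.
have D3 : 1 + w' * y != 0 by move: D2; rewrite mulrN opprK.
by rewrite N D; field; rewrite D2 D1 t0.
Qed.

End MobiusMeasure.

(** * Null sets and operators on L2 *)

Section MobiusNull.
Context {R : realType}.
Local Notation mu := (@arc_measure R).
Implicit Types (a : disc R) (z : circle R).

(** Apply [ge0_integral_mobius_jacobian] to [h * J], since
    [J (phi_a z) * J z = 1]. *)
Lemma ge0_integral_mobius a (h : circle R -> \bar R) :
  measurable_fun setT h -> (forall z, 0 <= h z)%E ->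
  (\int[mu]_z h (mobius_circle a z) = \int[mu]_z (h z * (mobius_jacobian a z)%:E))%E.
Proof.
move=> mh h0; rewrite -[RHS](@ge0_integral_mobius_jacobian _ a); first last.
- by move=> z; rewrite mule_ge0// lee_fin ltW// mobius_jacobian_gt0.
- apply: emeasurable_funM => //; apply/measurable_EFinP.
  exact: measurable_mobius_jacobian.
apply: eq_integral => z _.
by rewrite -muleA -EFinM mobius_jacobianM mule1.
Qed.

(** The preimage of a null set [N] has measure the integral of [J] over [N]. *)
Lemma ae_mobius a (P : circle R -> Prop) :
  (\forall z \ae mu, P z) -> \forall z \ae mu, P (mobius_circle a z).
Proof.
move=> [N [mN N0 PN]]; exists (mobius_circle a @^-1` N); split.
- by rewrite -[X in measurable X]setTI; exact: measurable_mobius_circle.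
- have mJ := @measurable_mobius_jacobian R a.
  have mphiN : measurable (mobius_circle a @^-1` N).
    by rewrite -[X in measurable X]setTI; exact: measurable_mobius_circle.
  transitivity (\int[mu]_z (\1_N (mobius_circle a z))%:E)%E.
    by rewrite (integral_indic mu measurableT mphiN) setIT.
  rewrite (ge0_integral_mobius a (h := fun z => (\1_N z)%:E))//.
    rewrite -[RHS](null_set_integral (mu := mu) mN (f := fun z => (mobius_jacobian a z)%:E))//.
      rewrite [RHS]integral_mkcond; apply: eq_integral => z _.
      by rewrite epatch_indic muleC.
    by apply: measurable_funTS; apply/measurable_EFinP.
  by apply/measurable_EFinP.
- by move=> z /= nP; apply: PN.
Qed.

Lemma ae_mobiusE a (P : circle R -> Prop) :
  (\forall z \ae mu, P z) <-> \forall z \ae mu, P (mobius_circle a z).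
Proof.
split; first exact: ae_mobius.
by move=> /(ae_mobius a); apply: filterS => z; rewrite mobius_circleK.
Qed.

(** [phi_0] is the reflection [z |-> - z], so that what is known of Moebius maps
    covers it. *)
Definition disc0 : disc R :=
  @Disc R 0 (eq_ind_r (fun x => x < 1) ltr01 (normr0 _)).

Lemma circle_opp_mobius z : circle_opp z = mobius_circle disc0 z.
Proof. by apply: val_inj; rewrite /= mobiusE conjc0 mul0r subr0 divr1 sub0r. Qed.

End MobiusNull.

Section L2Operators.
Context {R : realType}.
Local Notation mu := (@arc_measure R).
Local Notation H := (L2 R).
Implicit Types (a : disc R) (z : circle R) (x y : H).

Lemma L2_square_integrable x : square_integrable x.
Proof. by apply/asboolP; exact: (valP (repr x)). Qed.

Lemma L2P x y : x = y <-> \forall z \ae mu, x z = y z.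
Proof.
split=> [->|xy]; first exact: aeW.
by rewrite -[x]reprK -[y]reprK; apply/eqP/L2_eqP.
Qed.

Lemma L2_addE x y : \forall z \ae mu, L2eval (x + y) z = x z + y z.
Proof.
have /eqP/L2_eqP : \pi_(L2 R) (repr (x + y)) = \pi_(L2 R) (repr x + repr y).
  by rewrite pi_addE !reprK.
exact.
Qed.

Lemma L2_scaleE (c : R[i]) x : \forall z \ae mu, L2eval (c *: x) z = c * x z.
Proof.
have /eqP/L2_eqP : \pi_(L2 R) (repr (c *: x)) = \pi_(L2 R) (c *: repr x).
  by rewrite pi_scale !reprK.
exact.
Qed.

Lemma L2_oppE x : \forall z \ae mu, L2eval (- x) z = - x z.
Proof.
by rewrite -scaleN1r; apply: filterS (L2_scaleE (-1) x) => z ->; rewrite mulN1r.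
Qed.

Lemma square_integrable_le (f g : circle R -> R[i]) (C : R) :
  0 <= C -> cmeasurable f -> square_integrable g ->
  (\int[mu]_z (normc (f z) ^+ 2)%:E <= \int[mu]_z (C * normc (g z) ^+ 2)%:E)%E ->
  square_integrable f.
Proof.
move=> C0 mf [gR gI g2] fg; have [fR fI] := mf; split => //.
apply: le_lt_trans fg _.
under eq_integral do rewrite EFinM.
rewrite ge0_integralZl_EFin//.
- by apply: lte_mul_pinfty => //; rewrite lee_fin.
- by move=> z _; rewrite lee_fin sqr_ge0.
- by apply/measurable_EFinP; exact: cmeasurable_normc_sqr.
Qed.

Lemma normcC (r : R) : normc r%:C = `|r|.
Proof. by rewrite /= expr0n/= addr0 sqrtr_sqr. Qed.

Lemma cmeasurable_real (h : circle R -> R) :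
  measurable_fun setT h -> cmeasurable (fun z => (h z)%:C).
Proof. by move=> mh; split => //; exact: measurable_cst. Qed.

(** This keeps the junk value of [L2class] out of [multiplication]. *)
Lemma square_integrable_mul (h : circle R -> R) (C : R) (f : circle R -> R[i]) :
  measurable_fun setT h -> (forall z, `|h z| <= C) -> square_integrable f ->
  square_integrable (fun z => (h z)%:C * f z).
Proof.
move=> mh hC f2; have [fR fI _] := f2.
have mhf : cmeasurable (fun z => (h z)%:C * f z).
  by apply: cmeasurable_mul => //; exact: cmeasurable_real.
apply: (square_integrable_le (sqr_ge0 C) mhf f2).
apply: ge0_le_integral => //.
- by move=> z _; rewrite lee_fin sqr_ge0.
- by apply/measurable_EFinP; exact: cmeasurable_normc_sqr.
- apply/measurable_EFinP; apply: measurable_funM; first exact: measurable_cst.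
  exact: cmeasurable_normc_sqr.
- move=> z _; rewrite lee_fin normcM exprMn ler_wpM2r ?sqr_ge0// normcC.
  by rewrite lerXn2r ?nnegrE// (le_trans _ (hC z)).
Qed.

Lemma multiplicationE (h : circle R -> R) (C : R) x :
  measurable_fun setT h -> (forall z, `|h z| <= C) ->
  \forall z \ae mu, multiplication h x z = (h z)%:C * x z.
Proof.
move=> mh hC; apply: L2classK; apply: (square_integrable_mul mh hC).
exact: L2_square_integrable.
Qed.

End L2Operators.

(** * The weight and the square root of the Jacobian *)

Section Bounds.
Context {R : realType}.
Local Notation mu := (@arc_measure R).
Local Notation H := (L2 R).
Implicit Types (a : disc R) (z : circle R) (x y : H).

Lemma den_circle_le2 a z : normc (1 - conjc a * circle_val z) <= 2.
Proof.
rewrite -lecR -normcR rmorph_nat (le_trans (ler_normB _ _))//.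
rewrite normr1 normrM normcJ (eqP (circle_eq1 z)) mulr1 -[2]/(1 + 1) lerD2l.
exact: ltW (disc_lt1 a).
Qed.

Lemma den_circle_ge a z : 1 - normc a <= normc (1 - conjc a * circle_val z).
Proof.
rewrite -lecR -normcR rmorphB rmorph1 (le_trans _ (lerB_dist _ _))//.
by rewrite normr1 normrM normcJ (eqP (circle_eq1 z)) mulr1 normcR.
Qed.

Lemma onem_normc_gt0 a : 0 < 1 - normc a.
Proof. by rewrite subr_gt0 -normc_lt1; exact: disc_lt1. Qed.

Definition sqrt_jacobian a z : R := Num.sqrt (mobius_jacobian a z).

Lemma sqrt_jacobian_bounds a : exists c C : R,
  0 < c /\ forall z, c <= sqrt_jacobian a z <= C.
Proof.
have n0 := onem_normc_sqr_gt0 a; have d0 := onem_normc_gt0 a.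
exists (Num.sqrt ((1 - normc a ^+ 2) / 2 ^+ 2)),
  (Num.sqrt ((1 - normc a ^+ 2) / (1 - normc a) ^+ 2)).
split=> [|z]; first by rewrite sqrtr_gt0 divr_gt0// exprn_gt0.
have z0 := den_circle_gt0 a z.
by apply/andP; split; rewrite ler_sqrt ?divr_gt0 ?exprn_gt0//;
  rewrite ?divr_ge0 ?exprn_ge0 ?(ltW n0) ?(ltW d0) ?(ltW z0)//;
  rewrite ler_pM2l// lef_pV2 ?posrE ?exprn_gt0// lerXn2r ?nnegrE ?(ltW d0) ?(ltW z0)//
    ?den_circle_le2 ?den_circle_ge.
Qed.

Lemma sqrt_jacobian_gt0 a z : 0 < sqrt_jacobian a z.
Proof. by rewrite sqrtr_gt0 mobius_jacobian_gt0. Qed.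

Lemma measurable_fun_sqrt_ge0 d (T : measurableType d) (f : T -> R) :
  (forall t, 0 <= f t) ->
  measurable_fun setT f -> measurable_fun setT (fun t => Num.sqrt (f t)).
Proof.
move=> f0 mf; under eq_fun do rewrite -powR12_sqrt//.
exact: (measurableT_comp (measurable_powR _) mf).
Qed.

Lemma measurable_sqrt_jacobian a : measurable_fun setT (sqrt_jacobian a).
Proof.
apply: measurable_fun_sqrt_ge0 => [z|]; first exact/ltW/mobius_jacobian_gt0.
exact: measurable_mobius_jacobian.
Qed.

Lemma weight_gt0 a z : 0 < weight a z.
Proof. by rewrite sqrtr_gt0; exact: den_circle_gt0. Qed.


Lemma measurable_weight a : measurable_fun setT (weight a).
Proof.
apply: measurable_fun_sqrt_ge0 => [z|]; first exact: normc_ge0.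
rewrite (_ : (fun z => _) = fun z => Num.sqrt (normc (1 - conjc a * circle_val z) ^+ 2)).
  apply: measurable_fun_sqrt_ge0 => [z|]; first exact: sqr_ge0.
  exact/cmeasurable_normc_sqr/cmeasurable_den.
by apply/funext => z; rewrite sqrtr_sqr ger0_norm ?normc_ge0.
Qed.

Lemma weight_bounded a : exists C : R, forall z, `|weight a z| <= C.
Proof.
exists (Num.sqrt 2) => z; rewrite gtr0_norm ?weight_gt0// ler_sqrt//.
exact: den_circle_le2.
Qed.

Lemma weightV_bounded a : exists C : R, forall z, `|(weight a z)^-1| <= C.
Proof.
exists (Num.sqrt (1 - normc a))^-1 => z.
rewrite gtr0_norm ?invr_gt0 ?weight_gt0//.
rewrite lef_pV2 ?posrE ?weight_gt0 ?sqrtr_gt0 ?onem_normc_gt0//.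
by rewrite ler_sqrt ?normc_ge0//; exact: den_circle_ge.
Qed.

(** From [1 - conj a (phi_a z) = (1 - |a|^2) / (1 - conj a z)]. *)
Lemma weight_mobius a z :
  weight a (mobius_circle a z) = weight a z * sqrt_jacobian a z.
Proof.
have d0 := den_circle_gt0 a z; have n0 := onem_normc_sqr_gt0 a.
rewrite /weight /sqrt_jacobian -sqrtrM ?normc_ge0//; congr Num.sqrt.
rewrite [LHS](den_mobius_circle a z) /mobius_jacobian.
rewrite -[normc (1 - _ * circle_val z)]/(normc (1 - conjc a * circle_val z)).
by set d := normc _ in d0 *; field; rewrite gt_eqF.
Qed.

Lemma sqrt_jacobianM a z :
  sqrt_jacobian a (mobius_circle a z) * sqrt_jacobian a z = 1.
Proof.
by rewrite -sqrtrM ?mobius_jacobianM ?sqrtr1// ltW// mobius_jacobian_gt0.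
Qed.

(** This is [C_a^* C_a = M_J] at the level of quadratic forms. *)
Lemma integral_normc_mobius a (f : circle R -> R[i]) : cmeasurable f ->
  (\int[mu]_z (normc (f (mobius_circle a z)) ^+ 2)%:E =
   \int[mu]_z (normc ((sqrt_jacobian a z)%:C * f z) ^+ 2)%:E)%E.
Proof.
move=> mf; rewrite (ge0_integral_mobius a (h := fun z => (normc (f z) ^+ 2)%:E)).
- apply: eq_integral => z _; rewrite -EFinM normcM exprMn normcC.
  rewrite gtr0_norm ?sqrt_jacobian_gt0// sqr_sqrtr 1?mulrC//.
  exact/ltW/mobius_jacobian_gt0.
- by apply/measurable_EFinP; exact: cmeasurable_normc_sqr.
- by move=> z; rewrite lee_fin sqr_ge0.
Qed.

Lemma square_integrable_mobius a (f : circle R -> R[i]) :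
  square_integrable f -> square_integrable (f \o mobius_circle a).
Proof.
move=> f2; have [fR fI _] := f2.
have [c [C [c0 cC]]] := sqrt_jacobian_bounds a.
have [_ _ E] := @square_integrable_mul R (sqrt_jacobian a) C f (measurable_sqrt_jacobian a)
  (fun z => ltac:(rewrite gtr0_norm ?sqrt_jacobian_gt0//; by case/andP: (cC z))) f2.
split.
- exact: (measurableT_comp fR (measurable_mobius_circle a)).
- exact: (measurableT_comp fI (measurable_mobius_circle a)).
- by rewrite integral_normc_mobius.
Qed.

Lemma compositionE a x : \forall z \ae mu, composition a x z = x (mobius_circle a z).
Proof. exact/L2classK/square_integrable_mobius/L2_square_integrable. Qed.

End Bounds.

(** * The inner product of L2 *)

Section InnerProduct.
Context {R : realType}.
Local Notation mu := (@arc_measure R).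
Local Notation H := (L2 R).
Implicit Types (a : disc R) (z : circle R) (x y : H) (f g : circle R -> R[i]).

Definition cintegrable f :=
  mu.-integrable setT (EFin \o (fun z => cRe (f z))) /\
  mu.-integrable setT (EFin \o (fun z => cIm (f z))).

Lemma cmeasurable_add f g :
  cmeasurable f -> cmeasurable g -> cmeasurable (fun z => f z + g z).
Proof.
move=> [fR fI] [gR gI]; split.
  rewrite (_ : _ \o _ = fun z => cRe (f z) + cRe (g z)); first exact: measurable_funD.
  by apply/funext => z /=; case: (f z) (g z) => [? ?] [].
rewrite (_ : _ \o _ = fun z => cIm (f z) + cIm (g z)); first exact: measurable_funD.
by apply/funext => z /=; case: (f z) (g z) => [? ?] [].
Qed.

Lemma cmeasurable_conj f : cmeasurable f -> cmeasurable (fun z => conjc (f z)).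
Proof.
move=> [fR fI]; split.
  rewrite (_ : _ \o _ = cRe \o f)//.
  by apply/funext => z /=; case: (f z).
rewrite (_ : _ \o _ = fun z => - cIm (f z)); first exact: measurableT_comp.
by apply/funext => z /=; case: (f z).
Qed.

Lemma integrable_normc_sqr f : square_integrable f ->
  mu.-integrable setT (EFin \o (fun z => normc (f z) ^+ 2)).
Proof.
move=> [fR fI f2]; apply/integrableP; split.
  by apply/measurable_EFinP; exact: cmeasurable_normc_sqr.
by under eq_integral do rewrite /= ger0_norm ?sqr_ge0//.
Qed.

Lemma cintegrable_prod f g : square_integrable f -> square_integrable g ->
  cintegrable (fun z => f z * conjc (g z)).
Proof.
move=> f2 g2.
have mf : cmeasurable f by case: f2.
have mg : cmeasurable g by case: g2.
have [mR mI] := cmeasurable_mul mf (cmeasurable_conj mg).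
have iS : mu.-integrable setT (EFin \o (fun z => normc (f z) ^+ 2 + normc (g z) ^+ 2)).
  have := integrableD measurableT (integrable_normc_sqr f2) (integrable_normc_sqr g2).
  exact.
split; apply: (le_integrable measurableT _ _ iS);
  do ?[by apply/measurable_EFinP].
- move=> z _ /=; rewrite lee_fin !normc_sqr.
  rewrite [X in _ <= X]ger0_norm; last by rewrite !addr_ge0 ?sqr_ge0.
  case: (f z) (g z) => [p q] [r s] /=; rewrite ler_norml.
  have := sqr_ge0 (p - r); have := sqr_ge0 (p + r).
  have := sqr_ge0 (q - s); have := sqr_ge0 (q + s).
  by move=> ? ? ? ?; apply/andP; split; nra.
- move=> z _ /=; rewrite lee_fin !normc_sqr.
  rewrite [X in _ <= X]ger0_norm; last by rewrite !addr_ge0 ?sqr_ge0.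
  case: (f z) (g z) => [p q] [r s] /=; rewrite ler_norml.
  have := sqr_ge0 (p - s); have := sqr_ge0 (p + s).
  have := sqr_ge0 (q - r); have := sqr_ge0 (q + r).
  by move=> ? ? ? ?; apply/andP; split; nra.
Qed.

Lemma ae_eq_cintegral f g : cmeasurable f -> cmeasurable g ->
  (\forall z \ae mu, f z = g z) -> cintegral f = cintegral g.
Proof.
move=> [fR fI] [gR gI] fg; rewrite /cintegral /Rintegral; congr (fine _ +i* fine _).
  apply: ae_eq_integral => //; do ?[by apply/measurable_EFinP].
  by apply: filterS fg => z -> _.
apply: ae_eq_integral => //; do ?[by apply/measurable_EFinP].
by apply: filterS fg => z -> _.
Qed.

Lemma L2dotE x y f g : square_integrable f -> square_integrable g ->
  (\forall z \ae mu, x z = f z) -> (\forall z \ae mu, y z = g z) ->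
  L2dot x y = cintegral (fun z => f z * conjc (g z)).
Proof.
move=> f2 g2 xf yg; apply: ae_eq_cintegral.
- have [xR xI _] := L2_square_integrable x.
  have [yR yI _] := L2_square_integrable y.
  by apply: cmeasurable_mul => //; exact: cmeasurable_conj.
- case: f2 => ? ? _; case: g2 => ? ? _.
  by apply: cmeasurable_mul => //; exact: cmeasurable_conj.
- by apply: filterS2 xf yg => z -> ->.
Qed.

Lemma cintegral_lin (c : R[i]) f g : cintegrable f -> cintegrable g ->
  cintegral (fun z => c * f z + g z) = c * cintegral f + cintegral g.
Proof.
move=> [fR fI] [gR gI]; case: c => p q.
have iZ (k : R) (h : circle R -> R) : mu.-integrable setT (EFin \o h) ->
    mu.-integrable setT (EFin \o (fun z => k * h z)).
  by move=> ih; exact: (integrableZl measurableT k ih).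
have iB (h k : circle R -> R) : mu.-integrable setT (EFin \o h) ->
    mu.-integrable setT (EFin \o k) ->
    mu.-integrable setT (EFin \o (fun z => h z - k z)).
  by move=> ih ik; exact: (integrableB measurableT ih ik).
have iD (h k : circle R -> R) : mu.-integrable setT (EFin \o h) ->
    mu.-integrable setT (EFin \o k) ->
    mu.-integrable setT (EFin \o (fun z => h z + k z)).
  by move=> ih ik; exact: (integrableD measurableT ih ik).
rewrite /cintegral; apply/eqP; rewrite eq_complex; apply/andP; split; apply/eqP => /=.
  rewrite -!RintegralZl// -RintegralB//; do ?[exact: iZ].
  rewrite -RintegralD//; last by apply: iB; exact: iZ.
  by apply: eq_Rintegral => z _; case: (f z) (g z) => [? ?] [].
rewrite -!RintegralZl// -RintegralD//; do ?[exact: iZ].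
rewrite -RintegralD//; last by apply: iD; exact: iZ.
by apply: eq_Rintegral => z _; case: (f z) (g z) => [? ?] [].
Qed.

Lemma L2dotP (c : R[i]) x y (w : H) :
  L2dot (c *: x + y) w = c * L2dot x w + L2dot y w.
Proof.
have x2 := L2_square_integrable x; have y2 := L2_square_integrable y.
have w2 := L2_square_integrable w.
rewrite -cintegral_lin; [|exact: cintegrable_prod|exact: cintegrable_prod].
apply: ae_eq_cintegral.
- have [? ? _] := L2_square_integrable (c *: x + y); have [? ? _] := w2.
  by apply: cmeasurable_mul => //; exact: cmeasurable_conj.
- have [? ? _] := x2; have [? ? _] := y2; have [? ? _] := w2.
  apply: cmeasurable_add; last by apply: cmeasurable_mul => //; exact: cmeasurable_conj.
  apply: cmeasurable_mul; first exact: cmeasurable_cst.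
  by apply: cmeasurable_mul => //; exact: cmeasurable_conj.
- apply: filterS2 (L2_addE (c *: x) y) (L2_scaleE c x) => z -> ->.
  by rewrite mulrDl mulrA.
Qed.

Lemma L2dotC x y : L2dot y x = conjc (L2dot x y).
Proof.
rewrite /L2dot /cintegral; apply/eqP; rewrite eq_complex; apply/andP; split; apply/eqP => /=.
  apply: eq_Rintegral => z _; case: (x z) (y z) => [? ?] [? ?] /=; ring.
have [iR iI] := cintegrable_prod (L2_square_integrable x) (L2_square_integrable y).
rewrite -[RHS]mulN1r -RintegralZl//.
apply: eq_Rintegral => z _; case: (x z) (y z) => [? ?] [? ?] /=; ring.
Qed.

Lemma cintegral_weighted (h : circle R -> R) f :
  cintegral (fun z => (h z)%:C * f z * conjc (f z)) =
  (\int[mu]_z (h z * normc (f z) ^+ 2))%:C.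
Proof.
rewrite /cintegral; apply/eqP; rewrite eq_complex; apply/andP; split; apply/eqP => /=.
  by apply: eq_Rintegral => z _; rewrite normc_sqr; case: (f z) => ? ? /=; ring.
rewrite (@eq_Rintegral _ _ _ mu setT (fun=> 0)).
  by rewrite Rintegral_cst// mul0r.
by move=> z _; case: (f z) => ? ? /=; ring.
Qed.

Lemma cintegral_sqr f : cintegral (fun z => f z * conjc (f z)) =
  (\int[mu]_z (normc (f z) ^+ 2))%:C.
Proof.
have := cintegral_weighted (fun=> 1) f.
rewrite (_ : (fun z => _) = fun z => f z * conjc (f z)); last first.
  by apply/funext => z; rewrite rmorph1 mul1r.
by move=> ->; congr (_%:C); apply: eq_Rintegral => z _; rewrite mul1r.
Qed.

Lemma L2dot_ge0 x : 0 <= L2dot x x.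
Proof.
rewrite /L2dot (cintegral_sqr x) ler0c; apply: Rintegral_ge0 => z _.
exact: sqr_ge0.
Qed.

Lemma L2_zeroE : \forall z \ae mu, L2eval (0 : H) z = 0.
Proof.
by rewrite -(scale0r (0 : H)); apply: filterS (L2_scaleE 0 0) => z ->; rewrite mul0r.
Qed.

Lemma L2dot_eq0 x : L2dot x x = 0 -> x = 0.
Proof.
rewrite /L2dot (cintegral_sqr x) => /complexI; rewrite /Rintegral => int0.
have [xR xI x2] := L2_square_integrable x.
have mx : measurable_fun setT (fun z => (normc (x z) ^+ 2)%:E).
  by apply/measurable_EFinP; exact: cmeasurable_normc_sqr.
have {}int0 : (\int[mu]_z (normc (x z) ^+ 2)%:E = 0)%E.
  rewrite -[LHS]fineK ?int0// ge0_fin_numE//.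
  by apply: integral_ge0 => z _; rewrite lee_fin sqr_ge0.
apply/L2P; have := (ae_eq_integral_abs mu measurableT mx).1.
case=> [|N [mN N0 xN]].
  rewrite -[RHS]int0; apply: eq_integral => z _.
  by rewrite gee0_abs// lee_fin sqr_ge0.
have x0 : \forall z \ae mu, x z = 0.
  exists N; split => // z /= xz; apply: xN => /= H; apply: xz.
  have /eqP := H I; rewrite eqe sqrf_eq0 => /eqP; exact: eq0_normc.
by apply: filterS2 x0 L2_zeroE => z -> ->.
Qed.

End InnerProduct.

(** * The absolute value of a composition operator *)

Section Polar.
Context {R : realType}.
Local Notation mu := (@arc_measure R).
Local Notation H := (L2 R).
Variable a : disc R.
Implicit Types (z : circle R) (x y : H).

Let M : H -> H := multiplication (sqrt_jacobian a).

Lemma sqrt_jacobian_mulE x : \forall z \ae mu, M x z = (sqrt_jacobian a z)%:C * x z.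
Proof.
have [c [C [c0 cC]]] := sqrt_jacobian_bounds a.
apply: (multiplicationE (C := C)) => [|z]; first exact: measurable_sqrt_jacobian.
by rewrite gtr0_norm ?sqrt_jacobian_gt0//; have /andP[] := cC z.
Qed.

Let square_integrable_M x : square_integrable (fun z => (sqrt_jacobian a z)%:C * x z).
Proof.
have [c [C [c0 cC]]] := sqrt_jacobian_bounds a.
apply: (square_integrable_mul (C := C)) => [|z|]; first exact: measurable_sqrt_jacobian.
  by rewrite gtr0_norm ?sqrt_jacobian_gt0//; have /andP[] := cC z.
exact: L2_square_integrable.
Qed.

Let M_linear : linear M.
Proof.
move=> c x y; apply/L2P.
have E1 := sqrt_jacobian_mulE (c *: x + y); have E2 := L2_addE (c *: x) y.
have E3 := L2_scaleE c x; have E4 := L2_addE (c *: M x) (M y).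
have E5 := L2_scaleE c (M x); have E6 := sqrt_jacobian_mulE x.
have E7 := sqrt_jacobian_mulE y.
apply: filterS (filterI (filterI (filterI E1 E2) (filterI E3 E4)) (filterI E5 (filterI E6 E7))).
move=> z [[[-> ->] [-> ->]] [-> [-> ->]]]; ring.
Qed.

Lemma L2dot_mulE x y : L2dot (M x) y = L2dot x (M y).
Proof.
rewrite (L2dotE (square_integrable_M x) (L2_square_integrable y)
  (sqrt_jacobian_mulE x)); last exact: aeW.
rewrite (L2dotE (L2_square_integrable x) (square_integrable_M y) _
  (sqrt_jacobian_mulE y)); last exact: aeW.
congr cintegral; apply/funext => z.
case: (x z) (y z) => [p q] [r s] /=; apply/eqP; rewrite eq_complex/=.
by apply/andP; split; apply/eqP; ring.
Qed.

Lemma composition_isometric x : L2dot (composition a x) (composition a x) = L2dot (M x) (M x).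
Proof.
have x2 := L2_square_integrable x; have [xR xI _] := x2.
rewrite (L2dotE (square_integrable_mobius a x2) (square_integrable_mobius a x2)
  (compositionE a x) (compositionE a x)).
rewrite (L2dotE (square_integrable_M x) (square_integrable_M x)
  (sqrt_jacobian_mulE x) (sqrt_jacobian_mulE x)).
rewrite !cintegral_sqr; congr (fine _)%:C.
exact: integral_normc_mobius.
Qed.

(** [P^2 = C_a^* C_a] and [M^2 = M_J] have the same quadratic form by
    [composition_isometric], and [M] is bounded below because [J] is. *)
Lemma absolute_value_composition (P : H -> H) :
  absolute_value (composition a) P -> forall x, P x = M x.
Proof.
move=> [[[linP [K bP]] P0] [B [_ adjB] PP]].
pose PL : {linear H -> H} := HB.pack P (GRing.isLinear.Build _ _ _ _ P linP).
pose ML : {linear H -> H} := HB.pack M (GRing.isLinear.Build _ _ _ _ M M_linear).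
have [c [C [c0 cC]]] := sqrt_jacobian_bounds a.
apply: (@positive_square_root_unique R H (@L2dot R) (@L2dotP R) (@L2dotC R)
  (@L2dot_ge0 R) (@L2dot_eq0 R) PL ML (K ^+ 2) (C ^+ 2) c) => //=.
- move=> x; have := bP x; rewrite /L2norm => H1.
  have [Re0 Re1] : 0 <= cRe (L2dot x x) /\ 0 <= cRe (L2dot (P x) (P x)).
    by have := L2dot_ge0 x; have := L2dot_ge0 (P x); rewrite !lecE => /andP[_ ?] /andP[_ ?].
  have := ler_pM (sqrtr_ge0 _) (sqrtr_ge0 _) H1 H1.
  by rewrite -!expr2 exprMn !sqr_sqrtr.
- move=> x; suff : cRe (L2dot (M x) (M x)) <= C ^+ 2 * cRe (L2dot x x) by [].
  rewrite (L2dotE (square_integrable_M x) (square_integrable_M x)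
    (sqrt_jacobian_mulE x) (sqrt_jacobian_mulE x)).
  have ix := integrable_normc_sqr (L2_square_integrable x).
  rewrite [L2dot x x](cintegral_sqr x) cintegral_sqr /= -RintegralZl//.
  apply: le_Rintegral => //.
  + exact: (integrable_normc_sqr (square_integrable_M x)).
  + exact: (integrableZl measurableT (C ^+ 2) ix).
  + move=> z _; rewrite normcM exprMn ler_wpM2r ?sqr_ge0// normcC.
    have /andP[_ qC] := cC z; rewrite gtr0_norm ?sqrt_jacobian_gt0//.
    by rewrite lerXn2r ?nnegrE// ltW ?sqrt_jacobian_gt0// (lt_le_trans _ qC) ?sqrt_jacobian_gt0.
- move=> x; have x2 := L2_square_integrable x.
  suff : c%:C * L2dot x x <= L2dot (M x) x by [].
  rewrite (L2dotE (square_integrable_M x) x2 (sqrt_jacobian_mulE x)); last exact: aeW.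
  rewrite [L2dot x x](cintegral_sqr x) cintegral_weighted -rmorphM lecR.
  have ix := integrable_normc_sqr x2.
  rewrite -RintegralZl//; apply: le_Rintegral => //.
  + exact: (integrableZl measurableT c ix).
  + have [iR _] := cintegrable_prod (square_integrable_M x) x2.
    rewrite (_ : (_ \o _) =
        EFin \o (fun z => cRe ((sqrt_jacobian a z)%:C * x z * conjc (x z))))//.
    by apply/funext => z /=; rewrite normc_sqr; case: (x z) => p q /=; congr _%:E; ring.
  + by move=> z _; rewrite ler_wpM2r ?sqr_ge0//; have /andP[] := cC z.
- move=> x; have -> : P (P x) = B (composition a x) by exact: (congr1 (fun f => f x) PP).
  suff : L2dot (B (composition a x)) x = L2dot (M (M x)) x by [].
  rewrite L2dot_mulE -composition_isometric.
  by rewrite L2dotC -adjB -L2dotC.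
Qed.

End Polar.

(** * The eigenspaces of the unitary part *)

Section Nullspaces.
Context {R : realType}.
Local Notation mu := (@arc_measure R).
Local Notation H := (L2 R).
Implicit Types (a : disc R) (z : circle R) (x y : H).

Lemma multiplicationK (h k : circle R -> R) (Ch Ck : R) x :
  measurable_fun setT h -> measurable_fun setT k ->
  (forall z, `|h z| <= Ch) -> (forall z, `|k z| <= Ck) ->
  (forall z, h z * k z = 1) ->
  multiplication h (multiplication k x) = x.
Proof.
move=> mh mk hC kC hk; apply/L2P.
have Eh := multiplicationE (multiplication k x) mh hC.
apply: filterS2 Eh (multiplicationE x mk kC) => z -> ->.
by rewrite mulrA -rmorphM hk rmorph1 mul1r.
Qed.

Lemma composition_involutive a : involutive (@composition R a).
Proof.
move=> x; apply/L2P.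
have E := ae_mobius a (compositionE a x).
apply: filterS2 (compositionE a (composition a x)) E => z -> ->.
by rewrite mobius_circleK.
Qed.

(** [U M_(sqrt J) = C_a], and [M_(sqrt J)] is inverted by [M_(1 / sqrt J)]; the
    factor [1 / sqrt J] composed with [phi_a] is [sqrt J]. *)
Lemma polar_unitary_partE a (U : H -> H) x : polar_unitary_part (composition a) U ->
  \forall z \ae mu, U x z = (sqrt_jacobian a z)%:C * x (mobius_circle a z).
Proof.
move=> [_ [P /absolute_value_composition PM CUP]].
have [c [C [c0 cC]]] := sqrt_jacobian_bounds a.
have q0 := @sqrt_jacobian_gt0 R a; have mq := @measurable_sqrt_jacobian R a.
have qC z : `|sqrt_jacobian a z| <= C by rewrite gtr0_norm//; case/andP: (cC z).
have mqV : measurable_fun setT (fun z => (sqrt_jacobian a z)^-1).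
  by apply: measurable_fun_inv_ge0 => // z; exact/ltW/q0.
have qVc z : `|(sqrt_jacobian a z)^-1| <= c^-1.
  by rewrite gtr0_norm ?invr_gt0// lef_pV2 ?posrE//; case/andP: (cC z).
have UC y : U (multiplication (sqrt_jacobian a) y) = composition a y.
  by rewrite -PM; exact: (congr1 (fun f => f y) (esym CUP)).
rewrite -[x in U x](@multiplicationK _ _ _ _ x mq mqV qC qVc) => [|z]; last first.
  by rewrite divff// gt_eqF.
rewrite UC; set y := multiplication _ x.
have E : \forall z \ae mu, y (mobius_circle a z) =
    ((sqrt_jacobian a (mobius_circle a z))^-1)%:C * x (mobius_circle a z).
  by have := ae_mobius a (multiplicationE x mqV qVc).
apply: filterS2 (compositionE a y) E => z -> ->; congr (_ * _); congr (_%:C).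
apply: (mulfI (lt0r_neq0 (q0 (mobius_circle a z)))).
by rewrite divff ?gt_eqF// sqrt_jacobianM.
Qed.

(** This operator turns the unitary part of [C_a] into the reflection
    [f |-> f (- z)]. *)
Let transport a x := composition (omega a) (multiplication (weight a) x).

Lemma transportE a x : \forall z \ae mu, transport a x z =
  (weight a (mobius_circle (omega a) z))%:C * x (mobius_circle (omega a) z).
Proof.
have [C wC] := weight_bounded a.
have E := ae_mobius (omega a) (multiplicationE x (measurable_weight a) wC).
by apply: filterS2 (compositionE (omega a) (multiplication (weight a) x)) E => z -> ->.
Qed.

(** With [G = w x]: the eigenvalue equation multiplied by [w] reads
    [G o phi_a = e G]; composing with [phi_omega], which preserves null sets both
    ways, it becomes [G o phi_omega o (-1) = e (G o phi_omega)]. *)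
Lemma polar_unitary_eigenvector a (U : H -> H) (e : R[i]) x :
  polar_unitary_part (composition a) U ->
  (\forall z \ae mu, U x z = e * x z) <->
  (\forall z \ae mu, transport a x (circle_opp z) = e * transport a x z).
Proof.
move=> hU; pose G z := (weight a z)%:C * x z.
have GE z : G (mobius_circle a z) =
    (weight a z)%:C * ((sqrt_jacobian a z)%:C * x (mobius_circle a z)).
  by rewrite /G weight_mobius rmorphM mulrA.
have w0 z : (weight a z)%:C != 0.
  by rewrite -(rmorph0 (real_complex R)) (inj_eq (@complexI R)) gt_eqF// weight_gt0.
have step1 : (\forall z \ae mu, U x z = e * x z) <->
    (\forall z \ae mu, G (mobius_circle a z) = e * G z).
  split; apply: filterS2 (polar_unitary_partE x hU) => z -> H1.
    by rewrite GE H1 /G mulrCA.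
  by apply: (mulfI (w0 z)); rewrite -GE H1 /G mulrCA.
have step2 : (\forall z \ae mu, G (mobius_circle a z) = e * G z) <->
    (\forall z \ae mu, G (mobius_circle (omega a) (circle_opp z)) =
                       e * G (mobius_circle (omega a) z)).
  rewrite (ae_mobiusE (omega a)).
  by split; apply: filterS => z; rewrite mobius_omega.
have FE := transportE a x.
have FEopp : \forall z \ae mu, transport a x (circle_opp z) =
    G (mobius_circle (omega a) (circle_opp z)).
  by apply: filterS (ae_mobius disc0 FE) => z; rewrite -circle_opp_mobius.
rewrite step1 step2; split => E.
  by apply: filterS (filterI E (filterI FE FEopp)) => z [H1 [-> ->]].
by apply: filterS (filterI E (filterI FE FEopp)) => z [H1 [H2 H3]]; rewrite -H3 H1 H2.
Qed.

Lemma transport_preimage a (S : set H) :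
  [set f | S (transport a f)] =
  (multiplication (fun z => (weight a z)^-1) \o composition (omega a)) @` S.
Proof.
have [C wC] := weight_bounded a; have [D wVD] := weightV_bounded a.
have mw := @measurable_weight R a.
have mwV : measurable_fun setT (fun z => (weight a z)^-1).
  by apply: measurable_fun_inv_ge0 => // z; exact/ltW/weight_gt0.
have w0 z : weight a z != 0 by rewrite gt_eqF ?weight_gt0.
apply/seteqP; split => [f Sf|_ [x Sx <-]] /=.
  exists (transport a f) => //=; rewrite composition_involutive.
  by apply: (multiplicationK f mwV mw wVD wC) => z; rewrite mulVf.
rewrite /transport (multiplicationK _ mw mwV wC wVD) ?composition_involutive// => z.
by rewrite mulfV.
Qed.

End Nullspaces.

Theorem corollary3p6 (R : realType) (a : disc R) (Ra : L2 R -> L2 R)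
    (hRa : polar_unitary_part (composition a) Ra) :
  [/\ nullspace (Ra \- id)
        = [set f | even_subspace
                     (composition (omega a) (multiplication (weight a) f))],
      [set f | even_subspace
                 (composition (omega a) (multiplication (weight a) f))]
        = (multiplication (fun z => (weight a z)^-1) \o composition (omega a))
            @` even_subspace,
      nullspace (Ra \+ id)
        = [set g | odd_subspace
                     (composition (omega a) (multiplication (weight a) g))] &
      [set g | odd_subspace
                 (composition (omega a) (multiplication (weight a) g))]
        = (multiplication (fun z => (weight a z)^-1) \o composition (omega a))
            @` odd_subspace].
Proof.
have eigen e f := polar_unitary_eigenvector e f hRa.
have evenE x : even_subspace x <->
    \forall z \ae arc_measure R, x (circle_opp z) = 1 * x z.
  by split; apply: filterS => z ->; rewrite mul1r.
have oddE x : odd_subspace x <->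
    \forall z \ae arc_measure R, x (circle_opp z) = -1 * x z.
  by split; apply: filterS => z ->; rewrite mulN1r.
split; [|exact: transport_preimage| |exact: transport_preimage].
- apply/seteqP; split => f.
    move=> /subr0_eq/L2P E; apply/evenE/eigen.
    by apply: filterS E => z ->; rewrite mul1r.
  move=> /evenE/eigen E; rewrite /nullspace/=; apply/eqP; rewrite subr_eq0.
  by apply/eqP/L2P; apply: filterS E => z ->; rewrite mul1r.
- apply/seteqP; split => f.
    move=> /eqP; rewrite [_ f]/(Ra f + f) addr_eq0 => /eqP/L2P E; apply/oddE/eigen.
    by apply: filterS2 E (L2_oppE f) => z -> ->; rewrite mulN1r.
  move=> /oddE/eigen E; rewrite /nullspace/=; apply/eqP; rewrite addr_eq0.
  by apply/eqP/L2P; apply: filterS2 E (L2_oppE f) => z -> ->; rewrite mulN1r.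
Qed.
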